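(* Let $m\ge 1$ be an integer and let $f_m$ be a random real Laurent polynomial of degree $m$, i.e. a random element of $\mathrm{Trig}_m$ distributed according to the standard Gaussian measure associated with the scalar product $(f,g)=\frac{1}{2\pi}\int_0^{2\pi} f(\theta)g(\theta)\,d\theta$. Let $\mathcal P(f_m)$ denote the probability that a root of $f_m$ is real. Then: (a) the expected number of real roots of $f_m$ equals $2\sqrt{\frac{m(m+1)}{3}}$; (b) $\mathcal P(f_m)=\sqrt{\frac{m+1}{3m}}$; (c) $\lim_{m\to\infty}\mathcal P(f_m)=\frac{1}{\sqrt 3}$.
   Context: A Laurent polynomial is a function $P(z)=\sum_{k\in\Lambda}a_kz^k$ on $\mathbb C\setminus\{0\}$, with $\Lambda\subset\mathbb Z$ finite and $a_k\in\mathbb C$. Let $S=\{z\in\mathbb C: |z|=1\}$, parametrized by $z=e^{i\theta}$. A Laurent polynomial is called real if its values on $S$ are real; equivalently $a_{-k}=\overline{a_k}$ for all $k\in\mathbb Z$. A real root of a Laurent polynomial is a root lying in $S$. The degree of a real Laurent polynomial with spectrum $\Lambda$ is $\max_{k\in\Lambda}|k|$. Restriction to $S$ identifies the real vector space of real Laurent polynomials of degree $\le m$ with the space $\mathrm{Trig}_m$ of trigonometric polynomials $a_0+\sum_{k=1}^m(\alpha_k\cos(k\theta)+\beta_k\sin(k\theta))$ with real coefficients. $\mathrm{Trig}_m$ is regarded as a Euclidean subspace of the real space $L_2(S)$ with scalar product $(f,g)=\frac1{2\pi}\int_0^{2\pi} f(\theta)g(\theta)\,d\theta$. A random real Laurent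 polynomial of degree $m$ is a random element of $\mathrm{Trig}_m$ whose coordinates in an orthonormal basis are independent standard normal variables (almost surely it has degree exactly $m$). The probability $\mathcal P(f_m)$ that a root of $f_m$ is real is the expected number of real roots of $f_m$ divided by the almost sure number $2m$ of all roots of $f_m$ in $\mathbb C\setminus\{0\}$, counted with multiplicity. *)

(* Defs.v *)
From HB Require Import structures.
From mathcomp Require Import all_boot all_order all_algebra.
From mathcomp Require Import finmap complex.
From mathcomp Require Import all_classical all_reals all_analysis.

Set Implicit Arguments.
Unset Strict Implicit.
Unset Printing Implicit Defensive.

Import Order.TTheory GRing.Theory Num.Theory.
Import numFieldNormedType.Exports.

Local Open Scope classical_set_scope.
Local Open Scope ring_scope.

(* The spectrum of a Laurent polynomial is the support of its family of
   coefficients. *)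
Definition laurent (R : realType) := {fsfun int -> R[i] with 0}.

Definition laurent_eval (R : realType) (a : laurent R) (z : R[i]) : R[i] :=
  \sum_(k <- finsupp a) a k * z ^ k.

Definition laurent_deg (R : realType) (a : laurent R) : nat :=
  \max_(k <- finsupp a) `|k|%N.

Definition unit_circle (R : realType) : set R[i] := [set z | `|z| = 1].

Definition real_laurent (R : realType) (a : laurent R) : Prop :=
  forall z, unit_circle z -> laurent_eval a z \is Num.real.

Definition roots (R : realType) (a : laurent R) : set R[i] :=
  [set z | z != 0 /\ laurent_eval a z = 0].

Definition real_roots (R : realType) (a : laurent R) : set R[i] :=
  roots a `&` @unit_circle R.

(* The polynomial z ^ d * a(z), where d = laurent_deg a; at a nonzero point its
   roots and their multiplicities are those of a. *)
Definition laurent_numer (R : realType) (a : laurent R) : {poly R[i]} :=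
  \poly_(j < (2 * laurent_deg a).+1) a (j%:Z - (laurent_deg a)%:Z).

Definition root_mult (R : realType) (a : laurent R) (z : R[i]) : nat :=
  mup z (laurent_numer a).

(* With multiplicity; meaningful for a nonzero Laurent polynomial, for which
   the set of roots is finite. *)
Definition nroots (R : realType) (a : laurent R) : nat :=
  \sum_(z \in roots a) root_mult a z.

(* Number of distinct real roots, +oo for the zero Laurent polynomial. *)
Definition nreal_roots (R : realType) (a : laurent R) : \bar R :=
  counting (real_roots a).

(* The trigonometric polynomial t |-> a(exp(i t)); taking the real part loses
   nothing when a is real. *)
Definition circle_restr (R : realType) (a : laurent R) (t : R) : R :=
  complex.Re (laurent_eval a (Complex (cos t) (sin t))).

Definition Trig (R : realType) (m : nat) : set (R -> R) :=
  [set g | exists (a0 : R) (al be : nat -> R),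
     forall t, g t = a0 + \sum_(1 <= k < m.+1)
       (al k * cos (k%:R * t) + be k * sin (k%:R * t))].

Definition L2_prod (R : realType) (g h : R -> R) : R :=
  (2 * pi)^-1 *
  \int[@lebesgue_measure R]_(t in [set` `[0, 2 * pi]]) (g t * h t).

Definition Trig_orthonormal_basis (R : realType) (m n : nat)
    (e : 'I_n -> R -> R) : Prop :=
  [/\ forall i, Trig m (e i),
      forall i j, L2_prod (e i) (e j) = (i == j)%:R
    & forall g, Trig m g ->
        exists c : 'I_n -> R, forall t, g t = \sum_(i < n) c i * e i t].

Definition mutually_independent (R : realType) (d : measure_display)
    (T : measurableType d) (P : probability T R) (n : nat)
    (X : 'I_n -> {RV P >-> R}) : Prop :=
  forall (J : {set 'I_n}) (A : 'I_n -> set R),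
    (forall i, measurable (A i)) ->
    P (\bigcap_(i in [set` J]) (X i @^-1` A i)) =
    (\prod_(i in J) P (X i @^-1` A i))%E.

Definition standard_normal (R : realType) (d : measure_display)
    (T : measurableType d) (P : probability T R) (X : {RV P >-> R}) : Prop :=
  forall A : set R, measurable A -> distribution P X A = normal_prob 0 1 A.

(* The degree is only required to be at most m: it equals m almost surely. *)
Definition random_real_laurent (R : realType) (d : measure_display)
    (T : measurableType d) (P : probability T R) (m : nat)
    (f : T -> laurent R) : Prop :=
  (forall w, real_laurent (f w) /\ (laurent_deg (f w) <= m)%N) /\
  exists (n : nat) (e : 'I_n -> R -> R) (X : 'I_n -> {RV P >-> R}),
    [/\ Trig_orthonormal_basis m e,
        mutually_independent X,
        forall i, standard_normal (X i)
      & forall w t, circle_restr (f w) t = \sum_(i < n) X i w * e i t].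

Definition expected_nreal_roots (R : realType) (d : measure_display)
    (T : measurableType d) (P : probability T R) (f : T -> laurent R)
    : \bar R :=
  (\int[P]_w nreal_roots (f w))%E.

(* The value taken almost surely by the number of all roots (unique if it
   exists, 0 otherwise). *)
Definition as_nroots (R : realType) (d : measure_display)
    (T : measurableType d) (P : probability T R) (f : T -> laurent R) : nat :=
  xget 0%N [set N | {ae P, forall w, nroots (f w) = N}].

Definition prob_real_root (R : realType) (d : measure_display)
    (T : measurableType d) (P : probability T R) (f : T -> laurent R) : R :=
  fine (expected_nreal_roots P f) / (as_nroots P f)%:R.

(* Main.v *)
(* Call f(t) the restriction of f_m to the circle, at z = exp(i t). By the
   reproducing property of the Dirichlet kernel D = 1 + 2 sum_(k <= m) cos(k t),
   every orthonormal basis e of Trig_m satisfies sum_i e_i(s) e_i(t) = D(t - s),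
   so f(s) and f(t) are centred Gaussian with correlation cos(theta), where
   cos(theta) = D(t - s) / D(0). Rotating the coordinates (Givens rotations)
   reduces the pair (f(s), f(t)) to two independent normal variables, and the
   probability that f(s) and f(t) have different signs is theta / pi: it is an
   additive function of theta, by rotation invariance, with value 1/2 at pi/2.
   Almost surely f vanishes at no point of the dyadic grids of [0, 2 pi] and has
   no tangential zero, so the number of sign changes along the grid of step
   h = 2 pi / 2^k increases to the number of zeros as k grows. By monotone
   convergence the expected number of zeros is the limit of 2^k theta(h) / pi,
   and theta(h) / h tends to sqrt(-D''(0) / D(0)) = sqrt(m (m + 1) / 3). *)
Require Import Defs.
From HB Require Import structures.
From mathcomp Require Import all_boot all_order all_algebra.
From mathcomp Require Import finmap complex.
From mathcomp Require Import all_classical all_reals all_analysis.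
From mathcomp Require Import measurable_realfun ring lra zify.

Set Implicit Arguments.
Unset Strict Implicit.
Unset Printing Implicit Defensive.

Import Order.TTheory GRing.Theory Num.Theory.
Import numFieldNormedType.Exports.

Local Open Scope classical_set_scope.
Local Open Scope ring_scope.

(** * Invariance of the Gaussian plane under rotations *)

(** A sign change is an event on two values of f, so only bivariate Gaussian laws enter, and no
    joint law with the derivative of f. The obstacle is the set of tangential zeros, an uncountable
    union over t: a quadratic bound around such a zero, with an integer constant, replaces it by
    countably many events read on the grids. The angle formula is used for angles up to pi/2, which
    the correlation angle of neighbouring grid points satisfies once the grid is fine. The constants
    come from D(0) = 2m + 1 and -D''(0) = m(m+1)(2m+1)/3, and from 2^k h = 2 pi, by which 2^k
    theta(h) / pi = 2 theta(h) / h. The count of all roots in (b) goes through the polynomial z^m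
    f(z). Its constant and leading coefficients have the same real part, the scalar product of f
    with cos(m t). This is a nondegenerate Gaussian linear form, hence almost surely nonzero, so
    that the polynomial has degree 2m and does not vanish at 0. *)

Section affine.
Context {R : realType}.
Local Open Scope ereal_scope.
Local Notation mu := (@lebesgue_measure R).
Implicit Types a b : R.

Definition affine a b (x : measurableTypeR R) : measurableTypeR R :=
  (a * (x : R) + b)%R.

Lemma measurable_affine a b : measurable_fun setT (affine a b).
Proof. by apply: measurable_funD => //; apply: measurable_funM. Qed.

HB.instance Definition _ a b :=
  isMeasurableFun.Build _ _ _ _ (affine a b) (measurable_affine a b).

Lemma lebesgue_affine a b (a0 : (a != 0)%R) (A : set R) : measurable A ->
  `|a|%:E * pushforward mu (affine a b) A = mu A.
Proof.
move=> mA.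
have na0 : (0 <= `|a|)%R by [].
pose k : {nonneg R} := NngNum na0.
rewrite [RHS](@lebesgue_measure_unique _ (mscale k (pushforward mu (affine a b))))//.
move=> _ [[u v]/=] _ <-; rewrite /mscale/= /pushforward.
rewrite lebesgue_measure_itv/= lte_fin.
have [ap|an|a00] := ltgtP 0%R a.
- have -> : affine a b @^-1` `]u, v]%classic =
    [set` `]((u - b) / a)%R, ((v - b) / a)%R] ].
    apply/seteqP; split => x /=; rewrite !in_itv/= /affine;
      by rewrite ltr_pdivrMr// ler_pdivlMr// ltrBlDr lerBrDr (mulrC x).
  rewrite lebesgue_measure_itv/= lte_fin ltr_pM2r ?invr_gt0// ltrD2r.
  case: ifPn => // _; last by rewrite mule0.
  by rewrite -!EFinD -EFinM; congr EFin; rewrite gtr0_norm//; field.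
- have -> : affine a b @^-1` `]u, v]%classic =
    [set` `[((v - b) / a)%R, ((u - b) / a)%R[ ].
    apply/seteqP; split => x /=; rewrite !in_itv/= /affine;
      by rewrite ltr_ndivlMr// ler_ndivrMr// ltrBlDr lerBrDr (mulrC x) andbC.
  rewrite lebesgue_measure_itv/= lte_fin ltr_nM2r ?invr_lt0// ltrD2r.
  case: ifPn => // _; last by rewrite mule0.
  by rewrite -!EFinD -EFinM; congr EFin; rewrite ltr0_norm//; field; lra.
- by rewrite -a00 eqxx in a0.
Qed.

Lemma ge0_integral_affine a b (f : measurableTypeR R -> \bar R) : (a != 0)%R ->
  measurable_fun setT f -> (forall x, 0 <= f x) ->
  \int[mu]_x f x = `|a|%:E * \int[mu]_x f (a * x + b)%R.
Proof.
move=> a0 mf f0.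
have na0 : (0 <= `|a|)%R by [].
pose k : {nonneg R} := NngNum na0.
have <- := ge0_integral_pushforward (measurable_affine a b) mu measurableT mf
  (fun x _ => f0 x).
have <- := ge0_integral_mscale _ measurableT k mf (fun x _ => f0 x).
by apply: eq_measure_integral => A mA _; rewrite /= /mscale /= lebesgue_affine.
Qed.

End affine.

Section gauss2.
Context {R : realType}.
Local Open Scope ereal_scope.
Local Notation mu := (@lebesgue_measure R).
Local Notation phi := (@normal_pdf R 0 1).
Local Notation N01 := (@normal_prob R 0 1).

Import HBNNSimple.

(** The definition of [normal_prob] gives the case of indicators; simple functions follow by
    linearity, and general ones by monotone convergence on both sides. *)
Lemma ge0_integral_normal_prob (f : measurableTypeR R -> \bar R) :
  measurable_fun setT f -> (forall x, 0 <= f x) ->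
  \int[N01]_x f x = \int[mu]_x (f x * (phi x)%:E).
Proof.
move=> mf f0.
pose f_ := nnsfun_approx measurableT mf.
have mphi : measurable_fun setT (fun x : measurableTypeR R => (phi x)%:E).
  by apply/measurable_EFinP; exact: measurable_normal_pdf.
have phi0 x : 0 <= (phi x)%:E by rewrite lee_fin normal_pdf_ge0.
transitivity (limn (fun n => \int[N01]_x (f_ n x)%:E)).
  rewrite -monotone_convergence//=.
  - apply: eq_integral => x _; apply/esym/cvg_lim => //=.
    exact: cvg_nnsfun_approx.
  - by move=> n; apply/measurable_EFinP; exact: measurable_funTS.
  - by move=> n x _; rewrite lee_fin.
  - by move=> x _ a b ab; rewrite lee_fin//; exact/lefP/nd_nnsfun_approx.
transitivity (limn (fun n => \int[mu]_x ((f_ n x)%:E * (phi x)%:E))); last first.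
  rewrite -monotone_convergence//=.
  - apply: eq_integral => x _; apply/cvg_lim => //=.
    by apply: cvgeZr => //; exact: cvg_nnsfun_approx.
  - move=> n; apply: emeasurable_funM => //.
    apply/measurable_EFinP; exact: measurable_funTS.
  - by move=> n x _; rewrite mule_ge0// lee_fin.
  - move=> x _ a b ab; rewrite lee_wpmul2r// lee_fin.
    exact/lefP/nd_nnsfun_approx.
congr (limn _); apply/funext => n.
under eq_integral do rewrite fimfunE -fsumEFin//.
under [in RHS]eq_integral => x _.
  rewrite fimfunE -fsumEFin// ge0_mule_fsuml; last first.
    by move=> r; rewrite EFinM nnfun_muleindic_ge0.
  over.
rewrite !ge0_integral_fsum//; last 4 first.
- by move=> r; apply: emeasurable_funM => //; apply/measurable_EFinP; exact: measurable_funM.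
- by move=> r x _; rewrite mule_ge0// EFinM nnfun_muleindic_ge0.
- by move=> r; apply/measurable_EFinP; exact: measurable_funM.
- by move=> r x _; rewrite EFinM nnfun_muleindic_ge0.
apply: eq_fsbigr => r _.
have [r0|r0] := leP 0%R r; last first.
  rewrite !preimage_nnfun0// indic0.
  rewrite !integral0_eq// => x _ /=; rewrite ?mulr0 ?mul0e//.
have mp : measurable (f_ n @^-1` [set r]) by [].
under eq_integral do rewrite EFinM.
under [in RHS]eq_integral do rewrite EFinM -muleA.
rewrite !ge0_integralZl//; last 3 first.
- by apply: emeasurable_funM => //; by apply/measurable_EFinP; exact: measurable_indic.
- by move=> x _; rewrite mule_ge0// lee_fin.
- by apply/measurable_EFinP; exact: measurable_indic.
congr (_ * _); rewrite integral_indic// setIT /normal_prob [LHS]integral_mkcond.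
apply: eq_integral => x _; rewrite patchE indicE; case: ifPn => _;
  by rewrite ?mul1e ?mul0e.
Qed.

Lemma normal_probE (A : set (measurableTypeR R)) : measurable A ->
  N01 A = \int[mu]_x (\1_A x * phi x)%:E.
Proof.
move=> mA; rewrite /normal_prob integral_mkcond; apply: eq_integral => x _.
by rewrite patchE indicE; case: ifPn => _; rewrite ?mul1r ?mul0r.
Qed.

Definition rotation (c s : R) (z : measurableTypeR R * measurableTypeR R) :
    measurableTypeR R * measurableTypeR R :=
  ((c * z.1 + s * z.2)%R, (- s * z.1 + c * z.2)%R).

Lemma measurable_rotation c s : measurable_fun setT (rotation c s).
Proof.
apply/measurable_fun_pairP; split;
  by apply: measurable_funD; apply: measurable_funM.
Qed.

(** The product of the two densities depends only on [x ^+ 2 + y ^+ 2], which a rotation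
    preserves. *)
Lemma normal_pdf_rotation c s (x y : R) : (c ^+ 2 + s ^+ 2 = 1)%R ->
  (phi (s * x + c * y) * phi (c * x - s * y) = phi y * phi x)%R.
Proof.
move=> cs; rewrite /normal_pdf oner_eq0 /normal_fun.
rewrite mulrACA [in RHS]mulrACA -!expRD; congr (_ * expR _)%R.
rewrite -!mulrDl; congr (_ / _)%R; rewrite !subr0.
transitivity (- ((c ^+ 2 + s ^+ 2) * (x ^+ 2 + y ^+ 2)))%R; first by ring.
by rewrite cs; ring.
Qed.

(* The substitutions [v = c x + s y] at fixed [x], then [u = - s x + c y] at
   fixed [v], turn the rotation into two one-dimensional affine changes of
   variable separated by Tonelli's theorem. *)
Lemma normal_prob2_rotation_rect c s (A B : set (measurableTypeR R)) :
  (c ^+ 2 + s ^+ 2 = 1)%R -> (s != 0)%R -> measurable A -> measurable B ->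
  (N01 \x N01) (rotation c s @^-1` (A `*` B)) = N01 A * N01 B.
Proof.
move=> cs s0 mA mB.
set E := _ @^-1` _.
have mE : measurable E.
  by rewrite -[E]setTI; apply: measurable_rotation => //; exact: measurableX.
have mphi : measurable_fun setT (phi : measurableTypeR R -> _).
  exact: measurable_normal_pdf.
have m1 (D : set (measurableTypeR R)) : measurable D ->
  measurable_fun setT (\1_D : _ -> R) by move=> mD; exact: measurable_indic.
(* The integrand in the variables [(x, v)]: here [y = (v - c x) / s], the second rotated coordinate
   is [u = (c v - x) / s], and [|s^-1|] is the Jacobian. *)
pose G (z : measurableTypeR R * measurableTypeR R) : R :=
  (`|s^-1| * (\1_A z.2 * \1_B (- s^-1 * z.1 + c / s * z.2) *
     (phi (s^-1 * z.2 + - (c / s) * z.1) * phi z.1)))%R.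
have mG : measurable_fun setT G.
  apply: measurable_funM => //; apply: measurable_funM; apply: measurable_funM.
  - by apply: measurableT_comp => //; exact: m1.
  - apply: (measurableT_comp (m1 _ mB)).
    by apply: measurable_funD; apply: measurable_funM.
  - apply: (measurableT_comp mphi).
    by apply: measurable_funD; apply: measurable_funM.
  - exact: measurableT_comp.
have G0 z : (0 <= G z)%R by rewrite !mulr_ge0 ?normal_pdf_ge0.
rewrite /product_measure1 ge0_integral_normal_prob//; last first.
  exact: measurable_fun_xsection.
transitivity (\int[mu]_x \int[mu]_v (G (x, v))%:E).
  apply: eq_integral => x _.
  have mEx : measurable (xsection E x) by exact: measurable_xsection.
  rewrite /= normal_probE//.
  have m1Ep : measurable_fun setT
      (fun y : measurableTypeR R => (\1_(xsection E x) y * phi y)%R).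
    by apply: measurable_funM => //; exact: m1.
  rewrite (@ge0_integral_affine _ s^-1 (- (c / s) * x))//; first last.
  - by move=> y; rewrite lee_fin mulr_ge0 ?normal_pdf_ge0.
  - exact/measurable_EFinP.
  - by rewrite invr_eq0.
  rewrite muleAC -EFinM -ge0_integralZl//; first last.
  - by rewrite lee_fin mulr_ge0 ?normal_pdf_ge0.
  - by move=> y _; rewrite lee_fin mulr_ge0 ?normal_pdf_ge0.
  - apply/measurable_EFinP.
    exact: (measurableT_comp m1Ep (measurable_affine s^-1 (- (c / s) * x)%R)).
  apply: eq_integral => v _; rewrite -!EFinM; congr EFin.
  rewrite /G/= -[LHS]mulrA; congr (_ * _)%R.
  rewrite mulrCA; congr (_ * _)%R; last exact: mulrC.
  set y := (s^-1 * v + _)%R; set u := (- s^-1 * x + _)%R.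
  have yv : (c * x + s * y = v)%R by rewrite /y; field.
  have yu : (- s * x + c * y = u)%R.
    transitivity ((c * v - (c ^+ 2 + s ^+ 2) * x) / s)%R; first by rewrite /y; field.
    by rewrite cs /u; field.
  rewrite !indicE -natrM mulnb; congr (nat_of_bool _)%:R.
  apply/idP/andP; rewrite mem_xsection !inE /E/= yv yu; first by case.
  by case.
rewrite [LHS](fubini_tonelli (m1 := mu) (m2 := mu) (fun z => (G z)%:E)); last 2 first.
- exact/measurable_EFinP.
- by move=> z; rewrite lee_fin.
transitivity (\int[mu]_v ((\1_A v * phi v)%:E * N01 B)); last first.
  rewrite ge0_integralZr//; first by rewrite -normal_probE.
  - by apply/measurable_EFinP; apply: measurable_funM => //; exact: m1.
  - by move=> v _; rewrite lee_fin mulr_ge0// normal_pdf_ge0.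
apply: eq_integral => v _.
rewrite (@ge0_integral_affine _ (- s) (c * v))//; first last.
- by move=> x; rewrite lee_fin.
- exact/measurable_EFinP/(measurableT_comp mG).
- by rewrite oppr_eq0.
rewrite normal_probE// -!ge0_integralZl//; first last.
- by move=> x _; rewrite lee_fin.
- apply/measurable_EFinP; apply: (measurableT_comp mG).
  by apply: measurable_fun_pair => //; exact: (measurable_affine (- s) (c * v)%R).
- by rewrite lee_fin mulr_ge0// normal_pdf_ge0.
- by move=> x _; rewrite lee_fin mulr_ge0// normal_pdf_ge0.
- by apply/measurable_EFinP; apply: measurable_funM => //; exact: m1.
apply: eq_integral => u _; rewrite -!EFinM; congr EFin.
rewrite /G/= normrN.
have -> : (- s^-1 * (- s * u + c * v) + c / s * v = u)%R by field.
have -> : (s^-1 * v + - (c / s) * (- s * u + c * v) = s * v + c * u)%R.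
  transitivity (((c ^+ 2 + s ^+ 2) - c ^+ 2) / s * v + c * u)%R.
    by rewrite cs; field.
  by field.
have -> : (- s * u + c * v = c * v - s * u)%R by ring.
rewrite normal_pdf_rotation// normfV !mulrA divff ?normr_eq0//; ring.
Qed.

(** Rectangles determine a product measure, but the rectangle case divides by [s]; the two rotations
    with [s = 0] are treated apart. *)
Lemma normal_prob2_rotation c s (X : set (measurableTypeR R * measurableTypeR R)) :
  (c ^+ 2 + s ^+ 2 = 1)%R -> measurable X ->
  (N01 \x N01) (rotation c s @^-1` X) = (N01 \x N01) X.
Proof.
have rot_neq0 c' s' Y : (c' ^+ 2 + s' ^+ 2 = 1)%R -> (s' != 0)%R -> measurable Y ->
    (N01 \x N01) (rotation c' s' @^-1` Y) = (N01 \x N01) Y.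
  move=> cs s0 mY; pose rot : {mfun _ >-> _} := HB.pack (rotation c' s')
    (isMeasurableFun.Build _ _ _ _ _ (measurable_rotation c' s')).
  rewrite [RHS](@product_measure_unique _ _ _ _ _ N01 N01
    (pushforward (N01 \x N01) rot))//.
  by move=> A B mA mB; rewrite -(normal_prob2_rotation_rect cs).
move=> cs mX; have [s0|] := eqVneq s 0%R; last by move=> s0; exact: rot_neq0.
have /orP[/eqP c1|/eqP cN1] : (c == 1)%R || (c == -1)%R.
  by rewrite -eqf_sqr expr1n -cs s0 expr0n addr0.
- congr (_ _); apply/seteqP; split => -[x y];
    by rewrite /rotation/= s0 c1 oppr0 !mul0r !mul1r add0r addr0.
(* The half-turn is the square of the quarter-turn, for which [s = 1]. *)
- have -> : rotation c s @^-1` X = rotation 0 1 @^-1` (rotation 0 1 @^-1` X).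
    apply/seteqP; split => -[x y]; rewrite /rotation/= s0 cN1 oppr0;
      by rewrite !mul0r !mul1r !addr0 !add0r !mulN1r.
  have cs01 : (0 ^+ 2 + 1 ^+ 2 = 1 :> R)%R by rewrite expr0n expr1n add0r.
  rewrite !rot_neq0 ?oner_eq0// -[_ @^-1` _]setTI.
  exact: measurable_rotation.
Qed.

End gauss2.

(** * Families of independent standard normal variables *)

Section givens.
Context {R : realType} {I : finType}.
Implicit Types (a b u : I -> R).

Definition dotp a b := \sum_i a i * b i.

Definition givens (c s : R) (p q : I) a : I -> R := fun i =>
  if i == p then c * a p + s * a q
  else if i == q then - s * a p + c * a q else a i.

Lemma dotp_givens c s p q a b : p != q -> c ^+ 2 + s ^+ 2 = 1 ->
  dotp (givens c s p q a) (givens c s p q b) = dotp a b.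
Proof.
move=> pq cs; rewrite /dotp (bigD1 p)//= (bigD1 q) 1?eq_sym//=.
rewrite [RHS](bigD1 p)//= [in RHS](bigD1 q) 1?eq_sym//= !addrA.
congr (_ + _); last first.
  by apply: eq_bigr => i /andP[/negbTE ip /negbTE iq]; rewrite /givens ip iq.
rewrite /givens !eqxx eq_sym (negbTE pq).
transitivity ((c ^+ 2 + s ^+ 2) * (a p * b p + a q * b q)); first by ring.
by rewrite cs mul1r.
Qed.

End givens.

Section gaussian_family.
Context {R : realType} d (T : measurableType d) (P : probability T R).
Context {I : finType}.
Implicit Types X : I -> T -> measurableTypeR R.
Local Notation N01 := (@normal_prob R 0 1).

(** Independence and marginal laws in a single formula over the full index set; subfamilies are
    obtained with [A i = setT] at the other indices. *)
Definition gaussian_family X :=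
  (forall i, measurable_fun setT (X i)) /\
  forall A : I -> set (measurableTypeR R), (forall i, measurable (A i)) ->
    P (\bigcap_i (X i @^-1` A i)) = (\prod_i N01 (A i))%E.

(** Extends the product formula from rectangles to arbitrary planar events [F] for two of the
    variables, since a rotated rectangle is no longer a rectangle. *)
Lemma gaussian_family_pair X p q : gaussian_family X -> p != q ->
  forall F (A : I -> set (measurableTypeR R)),
  measurable F -> (forall i, measurable (A i)) ->
  P ((fun w => (X p w, X q w)) @^-1` F `&`
     \bigcap_(i in [set i | i != p /\ i != q]) (X i @^-1` A i)) =
  ((\prod_(i | (i != p) && (i != q)) N01 (A i)) * (N01 \x N01) F)%E.
Proof.
move=> [mX XA] pq F A mF mA.
set B := \bigcap_(i in _) _; set K := (\prod_(i | _) _)%E.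
have mB : measurable B.
  apply: fin_bigcap_measurable; first exact: finite_finset.
  by move=> i _; rewrite -[_ @^-1` _]setTI; exact: mX.
have mpair : measurable_fun setT (fun w => (X p w, X q w)).
  exact: measurable_fun_pair.
have PUV U V : measurable U -> measurable V ->
    P ((fun w => (X p w, X q w)) @^-1` (U `*` V) `&` B) =
    (K * (N01 U * N01 V))%E.
  move=> mU mV.
  pose A' i := if i == p then U else if i == q then V else A i.
  have := XA A'; rewrite (_ : \bigcap_i (X i @^-1` A' i) =
    (fun w => (X p w, X q w)) @^-1` (U `*` V) `&` B); last first.
    apply/seteqP; split => w /=.
      move=> h; split; first split.
      - by have := h p Logic.I; rewrite /A' eqxx.
      - by have := h q Logic.I; rewrite /A' eqxx eq_sym (negbTE pq).
      - move=> i /= [/negbTE ip /negbTE iq].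
        by have := h i Logic.I; rewrite /A' ip iq.
    move=> [[Up Vq] h] i _; rewrite /A'.
    have [->//|ip] := eqVneq i p; have [->//|iq] := eqVneq i q.
    exact: h.
  move=> ->; last by move=> i; rewrite /A'; do 2 case: ifP => // _.
  rewrite (bigD1 p)//= (bigD1 q) 1?eq_sym//= /A' !eqxx eq_sym (negbTE pq).
  rewrite muleA [RHS]muleC; congr (_ * _)%E.
  by apply: eq_bigr => i /andP[/negbTE -> /negbTE ->].
have K0 : (0 <= K)%E by apply: prode_ge0 => i _; exact: measure_ge0.
have PB : P B = K.
  have := PUV setT setT measurableT measurableT.
  by rewrite setXTT preimage_setT setTI => ->; rewrite !probability_setT !mule1.
have Kfin : K \is a fin_num by rewrite -PB fin_num_measure.
(* The conditioning event [B] has probability [K]; if [K = 0], both sides vanish. *)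
have [K00|K00] := eqVneq K 0%E.
  rewrite K00 mul0e; apply/eqP; rewrite -measure_le0 -K00 -PB.
  by apply: le_measure; rewrite ?inE//; apply: measurableI => //;
    rewrite -[_ @^-1` _]setTI; exact: mpair.
pose k := fine K.
have kK : k%:E = K by rewrite fineK.
have k0 : 0 < k by rewrite -lte_fin kK lt0e K00.
have ki0 : 0 <= k^-1 by rewrite invr_ge0 ltW.
pose XX : {mfun _ >-> _} := HB.pack (fun w => (X p w, X q w))
  (isMeasurableFun.Build _ _ _ _ _ mpair).
(* The conditional law of the pair given [B], identified with [N01 \x N01] by its values on
   rectangles. *)
pose m' := mscale (NngNum ki0) (pushforward (mrestr P mB) XX).
rewrite (@product_measure_unique _ _ _ _ _ N01 N01 (m' mpair))//.
- rewrite /m' /mscale/= /pushforward /mrestr -kK muleA -EFinM divff ?gt_eqF//.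
  by rewrite mul1e.
- move=> U V mU mV; transitivity (k^-1%:E *
    P ((fun w => (X p w, X q w)) @^-1` (U `*` V) `&` B))%E => //.
  by rewrite PUV// -kK muleA -EFinM mulVf ?gt_eqF// mul1e.
Qed.

Lemma gaussian_family_givens X c s p q : gaussian_family X -> p != q ->
  c ^+ 2 + s ^+ 2 = 1 ->
  gaussian_family (fun i w => givens c s p q (X ^~ w) i).
Proof.
move=> gX pq cs; have [mX XA] := gX; split.
  move=> i; rewrite /givens.
  have mD (a b : R) j k : measurable_fun setT
      (fun w => a * X j w + b * X k w : measurableTypeR R).
    by apply: measurable_funD;
      (apply: measurable_funM; [exact: measurable_cst|exact: mX]).
  by have [_|_] := eqVneq i p; [|have [_|_] := eqVneq i q].
move=> A mA.
have mR : measurable (rotation c s @^-1` (A p `*` A q)).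
  rewrite -[_ @^-1` _]setTI; apply: measurable_rotation => //.
  exact: measurableX.
have := gaussian_family_pair gX pq mR mA.
rewrite normal_prob2_rotation//; last exact: measurableX.
rewrite product_measure1E// => e.
rewrite (bigD1 p)//= (bigD1 q) 1?eq_sym//= muleA muleC -e; congr (P _).
apply/seteqP; split => w /=.
  move=> h; split; first split.
  - by have := h p Logic.I; rewrite /givens eqxx.
  - by have := h q Logic.I; rewrite /givens eqxx eq_sym (negbTE pq).
  - move=> i /= [/negbTE ip /negbTE iq].
    by have := h i Logic.I; rewrite /givens ip iq.
move=> [[Up Vq] h] i _; rewrite /givens /preimage/=.
have [->//|ip] := eqVneq i p; have [->//|iq] := eqVneq i q.
exact: h.
Qed.

(** Each [j] in [s] is cleared from [u] by a Givens rotation of the coordinates [p] and [j], which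
    moves the norm of the pair to [p]; hence the sign of [L u p] as soon as one rotation is made.
    The isometry [L] acts on every coefficient vector, so a second vector is carried along, and
    coordinates outside [p :: s] stay available for a further elimination. *)
Lemma gaussian_family_eliminate X u (p : I) (s : seq I) : gaussian_family X ->
  p \notin s -> exists Y (L : (I -> R) -> I -> R),
  [/\ gaussian_family Y, forall a b, dotp (L a) (L b) = dotp a b,
      forall a w, dotp (X ^~ w) a = dotp (Y ^~ w) (L a),
      forall a i, i \notin p :: s -> L a i = a i &
      (forall i, i \in s -> L u i = 0) /\ (s != [::] -> 0 <= L u p)].
Proof.
move=> gX; elim: s => [_|j s IH].
  by exists X, id; split => //; split.
rewrite inE negb_or => /andP[pj ps].
have [Y [L [gY iL XY Lid [Lu0 _]]]] := IH ps.
pose r := Num.sqrt (L u p ^+ 2 + L u j ^+ 2).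
(* When [r = 0] both coordinates are already 0, and the identity rotation is used. *)
pose c := if r == 0 then 1 else L u p / r.
pose t := if r == 0 then 0 else L u j / r.
have ge0 : 0 <= L u p ^+ 2 + L u j ^+ 2 by rewrite addr_ge0 ?sqr_ge0.
have r2 : r ^+ 2 = L u p ^+ 2 + L u j ^+ 2 by rewrite sqr_sqrtr.
have cs : c ^+ 2 + t ^+ 2 = 1.
  rewrite /c /t; have [_|r0] := eqVneq; first by rewrite expr0n expr1n addr0.
  by rewrite !expr_div_n -mulrDl -r2 divff// expf_eq0.
have rp : c * L u p + t * L u j = r.
  rewrite /c /t; have [r0|r0] := eqVneq.
    move: r2; rewrite r0 expr0n/= => /esym/eqP.
    rewrite paddr_eq0 ?sqr_ge0// !sqrf_eq0 => /andP[/eqP -> _].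
    by rewrite mulr0 mul0r addr0.
  by apply: (mulIf r0); rewrite -[RHS]expr2 r2; field.
have rj : - t * L u p + c * L u j = 0.
  rewrite /c /t; have [r0|r0] := eqVneq; last by field.
  move: r2; rewrite r0 expr0n/= => /esym/eqP.
  rewrite paddr_eq0 ?sqr_ge0// !sqrf_eq0 => /andP[_ /eqP ->].
  by rewrite oppr0 mulr0 mul0r addr0.
exists (fun i w => givens c t p j (Y ^~ w) i), (givens c t p j \o L); split.
- exact: gaussian_family_givens.
- by move=> a b; rewrite /= dotp_givens.
- by move=> a w; rewrite XY /= dotp_givens.
- move=> a i; rewrite !inE !negb_or => /and3P[/negbTE ip /negbTE ij is_].
  by rewrite /= /givens ip ij Lid// inE negb_or ip.
- split => [i|_] /=; last by rewrite /givens eqxx rp sqrtr_ge0.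
  rewrite inE /givens; have [->|ij /= is_] := eqVneq i j.
    by rewrite eq_sym (negbTE pj) rj.
  by rewrite (_ : (i == p) = false) ?Lu0//; apply: contraNF ps => /eqP <-.
Qed.

End gaussian_family.

(** * Sign changes of correlated Gaussian variables *)

Lemma cvg_div_expr2 (R : realType) (c : R) :
  c / 2 ^+ n @[n --> \oo] --> (0 : R).
Proof.
under eq_fun do rewrite -exprVn.
by apply: cvg_geometric; rewrite ger0_norm; lra.
Qed.

(* Replacing [x] by [2 x], or by [2 (c - x)] when [x > c / 2], doubles [`|r x|]
   and stays in [`]0, c]]. *)
Lemma additive_bounded_eq0 (R : realType) (c B : R) (r : R -> R) :
  (forall x y, 0 < x -> 0 < y -> x + y <= c -> r (x + y) = r x + r y) ->
  (forall x, 0 < x <= c -> `|r x| <= B) -> r c = 0 ->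
  forall x, 0 < x <= c -> r x = 0.
Proof.
move=> rD rB rc.
have half k : forall x, 0 < x <= c -> `|r x| <= B / 2 ^+ k.
  elim: k => [|k IH] x /andP[x0 xc]; first by rewrite divr1 rB// x0.
  have dbl y : 0 < y -> y + y <= c -> `|r y| <= B / 2 ^+ k.+1.
    move=> y0 yc; have := IH (y + y); rewrite rD// yc addr_gt0// => /(_ isT).
    rewrite -mulr2n normrMn -mulr_natr exprSr invfM mulrA => h; lra.
  have [xx|xx] := leP (x + x) c; first exact: dbl.
  have [->|xnc] := eqVneq x c.
    rewrite rc normr0 divr_ge0// ?exprn_ge0//.
    by apply: le_trans (rB c _); rewrite ?lexx ?(lt_le_trans x0).
  have cx0 : 0 < c - x by rewrite subr_gt0 lt_neqAle xnc.
  have := rD x (c - x) x0 cx0; rewrite subrKC lexx rc => /(_ isT) e.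
  have -> : r x = - r (c - x) by apply/eqP; rewrite -addr_eq0 -e.
  by rewrite normrN dbl//; lra.
move=> x xc; apply/eqP; rewrite -normr_le0.
by apply: (cvgr_to_ge (cvg_div_expr2 B)); near=> n; exact: half.
Unshelve. all: by end_near. Qed.

Lemma measurable_neqb d (T : measurableType d) (b1 b2 : T -> bool) :
  measurable [set w | b1 w] -> measurable [set w | b2 w] ->
  measurable [set w | b1 w != b2 w].
Proof.
move=> m1 m2; rewrite (_ : [set w | b1 w != b2 w] =
  ([set w | b1 w] `\` [set w | b2 w]) `|` ([set w | b2 w] `\` [set w | b1 w])).
  by apply: measurableU; exact: measurableD.
apply/seteqP; split => w /=; case: (b1 w); case: (b2 w) => //; first by left.
- by right.
- by case=> -[].
- by case=> -[].
Qed.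

Lemma measurable_lt0 d (T : measurableType d) (R : realType) (g : T -> R) :
  measurable_fun setT g -> measurable [set w | g w < 0].
Proof.
move=> mg; rewrite -[X in measurable X]setTI.
rewrite (_ : [set w | g w < 0] = g @^-1` `]-oo, 0[%classic); first exact: mg.
by apply/seteqP; split => w /=; rewrite in_itv.
Qed.

Lemma measurable_normr_le d (T : measurableType d) (R : realType) (g : T -> R)
  (c : R) : measurable_fun setT g -> measurable [set w | `|g w| <= c].
Proof.
move=> mg; rewrite -[X in measurable X]setTI.
rewrite (_ : [set w | `|g w| <= c] = g @^-1` `[- c, c]%classic); first exact: mg.
by apply/seteqP; split => w /=; rewrite in_itv/= ler_norml.
Qed.

Section sign_change.
Context {R : realType}.
Local Notation N01 := (@normal_prob R 0 1).
Local Notation N2 := (N01 \x N01)%E.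
Local Notation R2 := (measurableTypeR R * measurableTypeR R)%type.

(** Up to its boundary, a double wedge between the lines orthogonal to the directions [a] and
    [b]. *)
Definition sign_change (a b : R) : set R2 :=
  [set z | (cos a * z.1 + sin a * z.2 < 0) != (cos b * z.1 + sin b * z.2 < 0)].

Lemma measurable_sign_change a b : measurable (sign_change a b).
Proof.
by apply: measurable_neqb; apply: measurable_lt0;
  apply: measurable_funD; apply: measurable_funM.
Qed.

Lemma rotation_sign_change a b :
  rotation (cos a) (sin a) @^-1` sign_change 0 b = sign_change a (a + b).
Proof.
apply/seteqP; split => -[x y]; rewrite /sign_change /rotation /=;
  rewrite cos0 sin0 cosD sinD mul1r mul0r addr0;
  by congr (is_true (_ != (_ < _))); ring.
Qed.

Lemma normal_prob2_sign_change a b :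
  N2 (sign_change a (a + b)) = N2 (sign_change 0 b).
Proof.
rewrite -rotation_sign_change normal_prob2_rotation ?cos2Dsin2//.
exact: measurable_sign_change.
Qed.

Lemma normal_prob_setT : N01 setT = 1%E.
Proof. exact: (@probability_setT _ _ _ N01). Qed.

Lemma normal_prob2X (A B : set (measurableTypeR R)) : measurable A -> measurable B ->
  N2 (A `*` B) = (N01 A * N01 B)%E.
Proof. by move=> mA mB; exact: product_measure1E. Qed.

Lemma normal_prob2_setT : N2 setT = 1%E.
Proof. by rewrite -setXTT normal_prob2X// normal_prob_setT mule1. Qed.

(* The linear form at angle [a] is a positive combination of those at angles [0]
   and [a + b], so the two sign changes exclude each other. *)
Lemma sign_changeD a b : 0 < a -> 0 < b -> a + b <= pi / 2 ->
  N2 (sign_change 0 (a + b)) = (N2 (sign_change 0 a) + N2 (sign_change 0 b))%E.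
Proof.
move=> a0 b0 ab; have pi0 := @pi_gt0 R.
have sa : 0 < sin a by apply: sin_gt0_pi; apply/andP; lra.
have sb : 0 < sin b by apply: sin_gt0_pi; apply/andP; lra.
have sab : 0 < sin (a + b) by apply: sin_gt0_pi; apply/andP; lra.
pose L t (z : R2) : R := cos t * z.1 + sin t * z.2.
have LE (z : R2) : sin (a + b) * L a z = sin b * L 0 z + sin a * L (a + b) z.
  rewrite /L cos0 sin0 cosD sinD.
  have /(congr1 (fun t => sin b * (z.1 : R) * t)) := cos2Dsin2 a.
  by nra.
have key z : ~ ((L 0 z < 0) != (L a z < 0) /\ (L a z < 0) != (L (a + b) z < 0)).
  have := LE z.
  have [l0|l0] := ltP (L 0 z) 0; have [la|la] := ltP (L a z) 0;
    have [lb|lb] := ltP (L (a + b) z) 0 => // e [//]; nra.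
rewrite -[in X in (_ + X)%E](normal_prob2_sign_change a) -measureU.
- congr (N2 _); apply/seteqP; split => z.
    have := key z; rewrite /sign_change/= -/(L 0 z) -/(L a z) -/(L (a + b) z).
    by case: (L 0 z < 0); case: (L a z < 0); case: (L (a + b) z < 0) => // k _;
      first [by left|by right|by case: k].
  have := key z; rewrite /sign_change/= -/(L 0 z) -/(L a z) -/(L (a + b) z).
  by case: (L 0 z < 0); case: (L a z < 0); case: (L (a + b) z < 0) => // k [] // _;
    by case: k.
- exact: measurable_sign_change.
- exact: measurable_sign_change.
by apply/seteqP; split => // z [z1 z2]; exact: (key z).
Qed.

Lemma normal_prob_lt0 : N01 `]-oo, 0[ = (2^-1)%:E.
Proof.
have e : N01 `]-oo, 0[ = N01 `]0, +oo[.
  (* The symmetry of [N01] is read off the half-turn of the plane, applied to a half-plane. *)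
  have cs : (-1) ^+ 2 + 0 ^+ 2 = 1 :> R by rewrite sqrrN expr1n expr0n addr0.
  have mX : measurable (`]-oo, 0[%classic `*` setT : set R2).
    exact: measurableX.
  have := normal_prob2_rotation cs mX.
  rewrite (_ : rotation _ _ @^-1` _ = `]0, +oo[%classic `*` setT).
    by rewrite !normal_prob2X// normal_prob_setT !mule1.
  apply/seteqP; split => -[x y]; rewrite /rotation/= !in_itv/= andbT;
    by rewrite mul0r addr0 mulN1r oppr_lt0; case.
have z0 : N01 [set 0] = 0%E.
  by rewrite /normal_prob integral_set1.
have U3 : N01 setT = (N01 `]-oo, 0%R[ + (N01 `]0%R, +oo[ + N01 [set 0%R]))%E.
  rewrite (_ : setT = `]-oo, 0[ `|` (`]0, +oo[ `|` [set 0])); last first.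
    apply/seteqP; split => x //= _; rewrite !in_itv/= andbT.
    by have [?|?|->] := ltgtP x 0; [left|right; left|right; right].
  rewrite measureU//; last 2 first.
  - exact: measurableU.
  - apply/seteqP; split => x //=; rewrite !in_itv/= andbT => -[x0 []].
      by rewrite ltNge ltW.
    by move=> x00; rewrite x00 ltxx in x0.
  congr (_ + _)%E; rewrite measureU//.
  by apply/seteqP; split => x //=; rewrite !in_itv/= andbT => -[+ x0];
    rewrite x0 ltxx.
move: U3; rewrite normal_prob_setT z0 adde0 -e.
have : N01 `]-oo, 0[ \is a fin_num by exact: fin_num_measure.
move=> /fineK <-; rewrite -EFinD => -[h]; congr EFin; lra.
Qed.

Lemma normal_prob2_sign_change_pihalf : N2 (sign_change 0 (pi / 2)) = (2^-1)%:E.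
Proof.
have -> : sign_change 0 (pi / 2) =
   (`]-oo, 0[ `*` ~` `]-oo, 0[) `|` (~` `]-oo, 0[ `*` `]-oo, 0[).
  apply/seteqP; split => -[x y]; rewrite /sign_change/= cos0 sin0 cos_pihalf;
    rewrite sin_pihalf !mul1r !mul0r addr0 add0r !in_itv/=;
    by case: (x < 0); case: (y < 0) => //=;
      first [by left|by right|by case=> -[]].
have mN : measurable (`]-oo, 0[%classic : set (measurableTypeR R)) by [].
have mC := measurableC mN.
transitivity (N2 (`]-oo, 0%R[ `*` ~` `]-oo, 0%R[) +
    N2 (~` `]-oo, 0%R[ `*` `]-oo, 0%R[))%E.
  apply: measureU; [exact: measurableX|exact: measurableX|].
  by apply/seteqP; split => -[x y] //= [[? ?] []].
rewrite !normal_prob2X//.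
have -> : N01 (~` `]-oo, 0%R[) = (2^-1)%:E.
  have := normal_prob_lt0; rewrite /= => h.
  transitivity (1 - N01 `]-oo, 0%R[)%E; first exact: probability_setC.
  by rewrite h -EFinB; congr EFin; lra.
by rewrite normal_prob_lt0 -!EFinM -EFinD; congr EFin; lra.
Qed.

Lemma normal_prob2_sign_changeE a : 0 <= a <= pi / 2 ->
  N2 (sign_change 0 a) = (a / pi)%:E.
Proof.
move=> /andP[a0 ah]; have pi0 := @pi_gt0 R.
have Nle1 b : (N2 (sign_change 0 b) <= 1)%E.
  rewrite -normal_prob2_setT le_measure// inE//.
  exact: measurable_sign_change.
have Nfin b : N2 (sign_change 0 b) \is a fin_num.
  rewrite ge0_fin_numE//; exact: le_lt_trans (Nle1 b) (ltry _).
move: a0; rewrite le_eqVlt => /predU1P[<-|a0].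
  rewrite mul0r (_ : sign_change 0 0 = set0) ?measure0//.
  by apply/seteqP; split => z //=; rewrite /sign_change/= eqxx.
(* The defect from linearity: additive, bounded by 2, and 0 at [pi / 2]. *)
pose r x := fine (N2 (sign_change 0 x)) - x / pi.
suff : r a = 0 by move/eqP; rewrite subr_eq0 => /eqP <-; rewrite fineK.
apply: (@additive_bounded_eq0 _ (pi / 2) 2 r); last by rewrite a0.
- move=> x y x0 y0 xy; rewrite /r sign_changeD// fineD//.
  by rewrite mulrDl opprD addrACA.
- move=> x /andP[x0 xh]; rewrite /r (le_trans (ler_normB _ _))//.
  have n1 : `|fine (N2 (sign_change 0 x))| <= 1.
    by rewrite ger0_norm ?fine_ge0// -lee_fin fineK.
  have n2 : `|x / pi| <= 1.
    rewrite ger0_norm ?divr_ge0 ?(ltW x0) ?(ltW pi0)//.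
    by rewrite ler_pdivrMr//; lra.
  by rewrite -[leRHS]/(1 + 1) lerD.
- rewrite /r normal_prob2_sign_change_pihalf/=.
  by rewrite [pi / 2 / pi]mulrAC divff ?gt_eqF// mul1r subrr.
Qed.

End sign_change.

Section gaussian_linear_forms.
Context {R : realType} d (T : measurableType d) (P : probability T R).
Context {I : finType}.
Local Notation N01 := (@normal_prob R 0 1).
Local Notation N2 := (N01 \x N01)%E.
Local Notation R2 := (measurableTypeR R * measurableTypeR R)%type.
Implicit Types X : I -> T -> measurableTypeR R.

Lemma measurable_dotp X (u : I -> R) : gaussian_family P X ->
  measurable_fun setT (fun w => dotp (X ^~ w) u).
Proof.
move=> [mX _]; rewrite /dotp; apply: measurable_sum => i.
by apply: measurable_funM; [exact: mX|exact: measurable_cst].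
Qed.

Lemma dotp_only (p : I) (a b : I -> R) : (forall i, i != p -> b i = 0) ->
  dotp a b = a p * b p.
Proof.
move=> b0; rewrite /dotp (bigD1 p)//= big1 ?addr0// => i /b0 ->.
by rewrite mulr0.
Qed.

Lemma dotp_only2 (p q : I) (a b : I -> R) : p != q ->
  (forall i, i != p -> i != q -> b i = 0) ->
  dotp a b = a p * b p + a q * b q.
Proof.
move=> pq b0; rewrite /dotp (bigD1 p)//= (bigD1 q) 1?eq_sym//= big1 ?addr0//.
by move=> i /andP[ip iq]; rewrite b0// mulr0.
Qed.

Lemma gaussian_family1 X p (A : set (measurableTypeR R)) : gaussian_family P X ->
  measurable A -> P (X p @^-1` A) = N01 A.
Proof.
move=> [mX XA] mA; have := XA (fun i => if i == p then A else setT).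
rewrite (_ : \bigcap_i _ = X p @^-1` A); last first.
  apply/seteqP; split => w /=; first by move/(_ p Logic.I); rewrite eqxx.
  by move=> Xp i _; case: eqVneq => [->|].
move=> ->; last by move=> i; case: ifP.
rewrite (bigD1 p)//= eqxx big1 ?mule1// => i /negbTE ->.
exact: normal_prob_setT.
Qed.

(** After elimination the form is, up to sign, the norm of [u] times one standard normal variable.
    The bound is the length of the resulting interval times the maximum of the density. *)
Lemma gaussian_small_ball X (u : I -> R) (e : R) : gaussian_family P X ->
  0 < dotp u u -> 0 <= e ->
  (P [set w | (`|dotp (X ^~ w) u| <= e)%R] <=
   (2 * normal_peak 1 / Num.sqrt (dotp u u) * e)%:E)%E.
Proof.
move=> gX u0 e0.
have [p up] : exists p : I, u p != 0.
  apply/existsP; apply: contraTT u0 => /existsPn up0.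
  by rewrite -leNgt /dotp big1// => i _; have := up0 i; rewrite negbK => /eqP ->; rewrite mul0r.
have pN : p \notin [seq i <- enum I | i != p] by rewrite mem_filter eqxx.
have [Y [L [gY iL XY _ [Lu0 _]]]] := gaussian_family_eliminate u gX pN.
have {}Lu0 i : i != p -> L u i = 0.
  by move=> ip; apply: Lu0; rewrite mem_filter ip mem_enum.
have Lup : L u p ^+ 2 = dotp u u by rewrite -iL (dotp_only _ Lu0) expr2.
have rE : `|L u p| = Num.sqrt (dotp u u) by rewrite -Lup sqrtr_sqr.
set r := Num.sqrt _ in rE *.
have r0 : 0 < r by rewrite sqrtr_gt0.
have -> : [set w | `|dotp (X ^~ w) u| <= e] =
    Y p @^-1` `[- (e / r), e / r]%classic.
  apply/seteqP; split => w /=;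
    by rewrite in_itv/= -ler_norml ler_pdivlMr// -rE -normrM XY (dotp_only _ Lu0).
rewrite gaussian_family1//.
apply: (@le_trans _ _ (\int[lebesgue_measure]_(x in `[(- (e / r))%R, (e / r)%R])
  (normal_peak 1)%:E)%E).
  apply: ge0_le_integral => //=.
  - by move=> x _; rewrite lee_fin normal_pdf_ge0.
  - apply/measurable_EFinP; apply: measurable_funTS.
    exact: measurable_normal_pdf.
  - by move=> x _; rewrite lee_fin normal_pdf_ub ?oner_eq0.
rewrite integral_cst//= lebesgue_measure_itv/= lte_fin.
have er : 0 <= e / r by rewrite divr_ge0// ltW.
case: ifPn => _; last first.
  by rewrite mule0 lee_fin !mulr_ge0 ?invr_ge0 ?normal_peak_ge0 ?(ltW r0).
by rewrite -EFinD -EFinM lee_fin opprK le_eqVlt; apply/orP; left; apply/eqP; field; rewrite gt_eqF.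
Qed.

(** A first elimination puts [u] on the axis [p]; a second one, pivoting on [q] and leaving [p]
    alone, puts [v] in the plane of [p] and [q]. The event then concerns two independent normal
    variables. *)
Lemma gaussian_sign_change X (u v : I -> R) (rho a : R) : gaussian_family P X ->
  (1 < #|I|)%N -> 0 < rho -> dotp u u = rho -> dotp v v = rho ->
  dotp u v = rho * cos a -> 0 <= a <= pi / 2 ->
  P [set w | (dotp (X ^~ w) u < 0) != (dotp (X ^~ w) v < 0)] = (a / pi)%:E.
Proof.
move=> gX /card_gt1P[p [q [_ _ pq]]] rho0 uu vv uv a01.
pose s := [seq i <- enum I | i != p].
have ps : p \notin s by rewrite mem_filter eqxx.
have qs : q \in s by rewrite mem_filter eq_sym pq mem_enum.
have [Y [L [gY iL XY _ [Lu0 Lup]]]] := gaussian_family_eliminate u gX ps.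
have {}Lu0 i : i != p -> L u i = 0.
  by move=> ip; apply: Lu0; rewrite mem_filter ip mem_enum.
(* The index [q] makes [s] nonempty. The sign matters: dividing by [L u p] must not reverse the
   inequality. *)
have {}Lup : 0 <= L u p by apply: Lup; apply: contraTneq qs => ->.
pose s2 := [seq i <- enum I | (i != p) && (i != q)].
have qs2 : q \notin s2 by rewrite mem_filter eqxx andbF.
have [Z [M [gZ iM YZ Mid [Mv0 _]]]] := gaussian_family_eliminate (L v) gY qs2.
have {}Mid b : M b p = b p.
  by apply: Mid; rewrite inE negb_or pq mem_filter eqxx.
have {}Mv0 i : i != p -> i != q -> M (L v) i = 0.
  by move=> ip iq; apply: Mv0; rewrite mem_filter ip iq mem_enum.
have Lup2 : L u p ^+ 2 = rho by rewrite -uu -iL (dotp_only _ Lu0) expr2.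
pose r := Num.sqrt rho.
have r0 : 0 < r by rewrite sqrtr_gt0.
have r2 : r ^+ 2 = rho by rewrite sqr_sqrtr// ltW.
have Lur : L u p = r by rewrite /r -Lup2 sqrtr_sqr ger0_norm.
have vp : L v p = r * cos a.
  have : dotp (L u) (L v) = r ^+ 2 * cos a by rewrite iL uv r2.
  rewrite /dotp (bigD1 p)//= big1 ?addr0 => [|i /Lu0 ->]; last by rewrite mul0r.
  by rewrite Lur expr2 -mulrA => /mulfI; apply; rewrite gt_eqF.
have vq : M (L v) q ^+ 2 = (r * sin a) ^+ 2.
  have : dotp (M (L v)) (M (L v)) = r ^+ 2 by rewrite iM iL vv r2.
  rewrite (dotp_only2 _ pq Mv0) Mid vp -!expr2 => e.
  have : r ^+ 2 * cos a ^+ 2 + r ^+ 2 * sin a ^+ 2 = r ^+ 2.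
    by rewrite -mulrDr cos2Dsin2 mulr1.
  by rewrite !exprMn in e *; lra.
(* The isometry [M] fixes the coordinate [p] of [L u], which already carries its whole norm, so the
   other squares sum to 0. *)
have Mu i : i != p -> M (L u) i = 0.
  have : dotp (M (L u)) (M (L u)) = L u p ^+ 2.
    by rewrite iM (dotp_only _ Lu0) expr2.
  rewrite /dotp (bigD1 p)//= Mid -expr2 -[RHS]addr0 => /addrI.
  move/psumr_eq0P => h ip; have /eqP := h (fun j _ => sqr_ge0 _) i ip.
  by rewrite -expr2 sqrf_eq0 => /eqP.
(* Only the square of [M (L v) q] is known, so [t] will be [a] or [- a]. *)
have event (t : R) : M (L v) q = r * sin t -> cos t = cos a ->
    P [set w | (dotp (X ^~ w) u < 0) != (dotp (X ^~ w) v < 0)] =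
    N2 (sign_change 0 t).
  move=> vt ct.
  have := gaussian_family_pair gZ pq (measurable_sign_change 0 t)
    (fun=> measurableT).
  rewrite big1 ?mul1e => [<-|i _]; last exact: normal_prob_setT.
  congr (P _); rewrite (_ : \bigcap_(i in _) _ = setT) ?setIT; last first.
    by apply/seteqP; split => // w _ i _.
  apply/seteqP; split => w; rewrite /sign_change/= cos0 sin0 mul1r mul0r addr0.
    rewrite !XY !YZ (dotp_only _ Mu) (dotp_only2 _ pq Mv0) !Mid Lur vp vt ct.
    rewrite pmulr_llt0// (_ : _ + _ = (cos a * Z p w + sin t * Z q w) * r) ?pmulr_llt0//.
    by ring.
  rewrite !XY !YZ (dotp_only _ Mu) (dotp_only2 _ pq Mv0) !Mid Lur vp vt ct.
  rewrite pmulr_llt0// (_ : _ * (r * _) + _ = (cos a * Z p w + sin t * Z q w) * r) ?pmulr_llt0//.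
  by ring.
move/eqP: vq; rewrite eqf_sqr => /orP[/eqP vq|/eqP vq].
  by rewrite (event a)// normal_prob2_sign_changeE.
(* The rotation by [a] maps the sign change between [0] and [- a] to the one
   between [a] and [0]. *)
rewrite (event (- a)) ?cosN ?sinN ?mulrN//.
have := normal_prob2_sign_change a (- a); rewrite subrr => <-.
rewrite (_ : sign_change a 0 = sign_change 0 a) ?normal_prob2_sign_changeE//.
by apply/seteqP; split => z; rewrite /sign_change/= eq_sym.
Qed.

End gaussian_linear_forms.

(** * Trigonometric polynomials *)

Section circle_mean.
Context {R : realType}.
Implicit Types (g h : R -> R) (s : seq (R * nat * R)).

Definition circle_mean g : R :=
  (2 * pi)^-1 * \int[@lebesgue_measure R]_(t in [set` `[0, 2 * pi]]) g t.

Lemma integrable_circle g : continuous g ->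
  (@lebesgue_measure R).-integrable [set` `[0, 2 * pi]] (EFin \o g).
Proof.
move=> cg; apply: continuous_compact_integrable; first exact: segment_compact.
exact: continuous_subspaceT.
Qed.

Lemma circle_meanD g h : continuous g -> continuous h ->
  circle_mean (fun t => g t + h t) = circle_mean g + circle_mean h.
Proof.
move=> cg ch; rewrite /circle_mean -mulrDr -RintegralD//;
  exact: integrable_circle.
Qed.

Lemma circle_meanZ c g : continuous g ->
  circle_mean (fun t => c * g t) = c * circle_mean g.
Proof.
move=> cg; rewrite /circle_mean RintegralZl//; last exact: integrable_circle.
by rewrite mulrCA.
Qed.

Lemma continuous_sumf (I : Type) (r : seq I) (F : I -> R -> R) :
  (forall i, continuous (F i)) -> continuous (fun t => \sum_(i <- r) F i t).
Proof.
move=> cF; elim: r => [|i r IH] t.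
  by under eq_fun do rewrite big_nil; exact: cvg_cst.
under eq_fun do rewrite big_cons.
by apply: cvgD; [exact: cF|exact: IH].
Qed.

Lemma circle_mean_sum (I : Type) (r : seq I) (F : I -> R -> R) :
  (forall i, continuous (F i)) ->
  circle_mean (fun t => \sum_(i <- r) F i t) = \sum_(i <- r) circle_mean (F i).
Proof.
move=> cF; elim: r => [|i r IH].
  under [X in circle_mean X]eq_fun do rewrite big_nil.
  by rewrite big_nil /circle_mean Rintegral_cst// mul0r mulr0.
under [X in circle_mean X]eq_fun do rewrite big_cons.
by rewrite big_cons circle_meanD ?IH//; exact: continuous_sumf.
Qed.

Lemma is_derive_wave (c x a t : R) :
  is_derive t 1 (fun t => c * sin (x * t - a)) (c * x * cos (x * t - a)).
Proof.
have h : is_derive t 1 (fun t : R => x * t - a) x.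
  apply: (is_derive_eq (is_deriveB (is_deriveZ x (is_derive_id t 1))
    (is_derive_cst a t 1))).
  by rewrite subr0 /GRing.scale/= mulr1.
apply: (is_derive_eq (is_deriveZ c (is_derive1_comp (is_derive_sin _) h))).
by rewrite /GRing.scale/= [cos _ * _]mulrC mulrA.
Qed.

Lemma continuous_wave (x a : R) : continuous (fun t => cos (x * t - a)).
Proof.
move=> t; apply: continuous_comp; last exact: continuous_cos.
by apply: cvgB; [apply: cvgM; [exact: cvg_cst|exact: cvg_id]|exact: cvg_cst].
Qed.

Lemma circle_mean_cos (n : nat) (a : R) :
  circle_mean (fun t => cos (n%:R * t - a)) = (n == 0)%:R * cos a.
Proof.
have pi0 := @pi_gt0 R.
have [->|n0] := eqVneq n 0.
  under [X in circle_mean X]eq_fun do rewrite mul0r sub0r cosN.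
  rewrite /circle_mean Rintegral_cst// mul1r.
  have mE : @lebesgue_measure R `[0, 2 * pi]%classic = (2 * pi)%:E.
    by rewrite lebesgue_measure_itv/= lte_fin mulr_gt0//= -EFinB subr0.
  rewrite [fine _](_ : _ = 2 * pi); last exact: (congr1 fine mE).
  by rewrite mulrCA mulVf ?mulr1// gt_eqF ?mulr_gt0.
have nR : n%:R != 0 :> R by rewrite pnatr_eq0.
rewrite mul0r /circle_mean /Rintegral.
pose F t := n%:R^-1 * sin (n%:R * t - a).
rewrite (@continuous_FTC2 _ _ F) ?mulr_gt0//.
- rewrite /F -EFinB/= -mulrBr mulr0 sub0r (_ : n%:R * _ - a = - a + (pi *+ 2) *+ n).
    by rewrite periodicn ?subrr ?mulr0//; exact: sinD2pi.
  by rewrite addrC -[pi *+ 2 *+ n]mulr_natl -[pi *+ 2]mulr_natl.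
- by apply: continuous_subspaceT; exact: continuous_wave.
- have dF t : derivable F t 1 by have [] := is_derive_wave n%:R^-1 n%:R a t.
  have cF : continuous F.
    by move=> t; apply/differentiable_continuous/derivable1_diffP.
  split => //; first exact/cvg_at_right_filter/cF.
  exact/cvg_at_left_filter/cF.
- move=> t _; rewrite derive1E.
  have [_ ->] := is_derive_wave n%:R^-1 n%:R a t.
  by rewrite mulVf// mul1r.
Qed.

(** Product-to-sum formula: the frequency [k - l] survives in the mean only for [k = l], the
    frequency [k + l] only for [k = l = 0]. *)
Lemma circle_mean_coscos (k l : nat) (a b : R) :
  circle_mean (fun t => cos (k%:R * t - a) * cos (l%:R * t - b)) =
  2^-1 * ((k == l)%:R * cos (a - b) + (k + l == 0)%N%:R * cos (a + b)).
Proof.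
wlog lk : k l a b / (l <= k)%N.
  move=> h; have /orP[|kl] := leq_total l k; first exact: h.
  under [X in circle_mean X]eq_fun do rewrite mulrC.
  by rewrite h// eq_sym addnC -[in cos (b - a)]opprB cosN (addrC b).
transitivity (circle_mean (fun t => 2^-1 *
  (cos ((k - l)%N%:R * t - (a - b)) + cos ((k + l)%N%:R * t - (a + b))))).
  congr circle_mean; apply/funext => t.
  have -> : (k - l)%N%:R * t - (a - b) = (k%:R * t - a) - (l%:R * t - b) :> R.
    by rewrite natrB//; ring.
  have -> : (k + l)%N%:R * t - (a + b) = (k%:R * t - a) + (l%:R * t - b) :> R.
    by rewrite natrD//; ring.
  move: (k%:R * t - a) (l%:R * t - b) => A B.
  by rewrite cosB cosD; field.
rewrite circle_meanZ; last first.
  by move=> t; apply: cvgD; exact: continuous_wave.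
rewrite circle_meanD; try exact: continuous_wave.
rewrite !circle_mean_cos (_ : (k - l == 0)%N = (k == l))//.
by rewrite subn_eq0 eqn_leq lk andbT.
Qed.

(** Triples (amplitude, frequency, phase): sines are cosines of phase [pi / 2] and constants have
    frequency 0, so one kind of term covers all of [Trig]. *)
Definition waves s (t : R) : R :=
  \sum_(x <- s) x.1.1 * cos (x.1.2%:R * t - x.2).

Lemma Trig_waves m g : Trig m g ->
  exists2 s, all (fun x => (x.1.2 <= m)%N) s & g = waves s.
Proof.
move=> [a0 [al [be gE]]].
exists ((a0, 0%N, 0) :: flatten [seq [:: (al k, k, 0); (be k, k, pi / 2)] |
  k <- index_iota 1 m.+1]).
  apply/allP => x; rewrite inE => /predU1P[->//|/flattenP[_ /mapP[k + ->]]].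
  by rewrite mem_index_iota ltnS !inE => /andP[_ km] /orP[] /eqP ->.
apply/funext => t; rewrite gE /waves big_cons/= mul0r subr0 cos0 mulr1.
congr (_ + _); rewrite big_flatten big_map; apply: eq_bigr => k _.
by rewrite !big_cons big_nil/= addr0 subr0 cosBpihalf.
Qed.

Lemma continuous_waves s : continuous (waves s).
Proof.
apply: continuous_sumf => -[[c k] a] t.
by apply: cvgM; [exact: cvg_cst|exact: continuous_wave].
Qed.

Lemma continuous_Trig m g : Trig m g -> continuous g.
Proof. by move=> /Trig_waves[s _ ->]; exact: continuous_waves. Qed.

Definition dirichlet m (t : R) : R := 1 + \sum_(1 <= k < m.+1) 2 * cos (k%:R * t).

Lemma dirichlet_Trig m x : Trig m (fun t => dirichlet m (t - x)).
Proof.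
exists 1, (fun k => 2 * cos (k%:R * x)), (fun k => 2 * sin (k%:R * x)) => t.
congr (_ + _); apply: eq_bigr => k _.
by rewrite mulrBr cosB; ring.
Qed.

Lemma dirichlet_reproducing m x g : Trig m g ->
  L2_prod (fun t => dirichlet m (t - x)) g = g x.
Proof.
move=> /Trig_waves[s sm ->]; rewrite [LHS]/L2_prod -[LHS]/(circle_mean _).
pose K t := dirichlet m (t - x).
have cK : continuous K by exact: continuous_Trig (dirichlet_Trig m x).
under [X in circle_mean X]eq_fun do rewrite /waves mulr_sumr.
rewrite circle_mean_sum; last first.
  move=> [[c k] a] t /=; apply: cvgM; first exact: cK.
  by apply: cvgM; [exact: cvg_cst|exact: continuous_wave].
rewrite /waves !big_seq; apply: eq_bigr => -[[c l] a] /(allP sm)/= lm.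
under [X in circle_mean X]eq_fun do rewrite mulrCA.
have cW : continuous (fun t : R => cos (l%:R * t - a)) by exact: continuous_wave.
have cKW : continuous (fun t : R => K t * cos (l%:R * t - a)).
  by move=> t; apply: cvgM; [exact: cK|exact: cW].
rewrite circle_meanZ//; congr (_ * _).
transitivity (circle_mean (fun t => cos (l%:R * t - a) +
  \sum_(1 <= k < m.+1) 2 * (cos (k%:R * t - k%:R * x) * cos (l%:R * t - a)))).
  congr circle_mean; apply/funext => t; rewrite /dirichlet mulrDl mul1r.
  congr (_ + _); rewrite mulr_suml; apply: eq_bigr => k _.
  by rewrite mulrA mulrBr.
have c2 k : continuous (fun t : R =>
    2 * (cos (k%:R * t - k%:R * x) * cos (l%:R * t - a))).
  move=> t; apply: cvgM; first exact: cvg_cst.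
  by apply: cvgM; [exact: continuous_wave|exact: cW].
rewrite circle_meanD//; last exact: continuous_sumf.
rewrite circle_mean_sum// circle_mean_cos.
under eq_bigr => k _.
  rewrite circle_meanZ ?circle_mean_coscos; last first.
    by move=> t; apply: cvgM; [exact: continuous_wave|exact: cW].
  rewrite mulrA divff ?mul1r//.
  over.
(* Frequency 0 is reproduced by the constant term 1 of the kernel, a frequency [l > 0] by its term
   of index [l], whose factor 2 compensates the mean 1/2. *)
have [l0|l0] := eqVneq l 0%N.
  rewrite l0 mul1r mul0r sub0r cosN big_nat_cond big1 ?addr0// => k.
  by rewrite andbT => /andP[k0 _]; rewrite addn0 gtn_eqF// !mul0r addr0.
rewrite mul0r add0r (bigD1_seq l)/= ?mem_index_iota ?iota_uniq ?lt0n ?l0 ?ltnS//.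
rewrite eqxx addn_eq0 (negbTE l0) mul1r mul0r addr0 big1_seq ?addr0.
  by rewrite -cosN opprB.
move=> k /andP[/negbTE -> _].
by rewrite addn_eq0 (negbTE l0) andbF !mul0r addr0.
Qed.
End circle_mean.

(** * Orthonormal bases and the Dirichlet kernel *)

Section orthonormal_basis.
Context {R : realType}.
Variables (m n : nat) (e : 'I_n -> R -> R).
Hypothesis onb : Trig_orthonormal_basis m e.

Let eT i : Trig m (e i). Proof. by case: onb. Qed.
Let ec i : continuous (e i). Proof. exact: continuous_Trig (eT i). Qed.

Lemma L2_prod_lincomb (c : 'I_n -> R) (g h : R -> R) : continuous h ->
  (forall t, g t = \sum_(i < n) c i * e i t) ->
  L2_prod g h = \sum_(i < n) c i * L2_prod (e i) h.
Proof.
move=> ch gE; rewrite [LHS]/L2_prod -[LHS]/(circle_mean _).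
have ceh i : continuous (fun t : R => e i t * h t).
  by move=> t; apply: cvgM; [exact: ec|exact: ch].
transitivity (circle_mean (fun t => \sum_(i < n) c i * (e i t * h t))).
  congr circle_mean; apply/funext => t; rewrite gE mulr_suml.
  by apply: eq_bigr => i _; rewrite mulrA.
rewrite circle_mean_sum; first by apply: eq_bigr => i _; rewrite circle_meanZ.
by move=> i t; apply: cvgM; [exact: cvg_cst|exact: ceh].
Qed.

(** The kernel centred at [x] is expanded in the basis; its coefficient on [e j] is a scalar
    product, which the reproducing property evaluates to [e j x]. *)
Lemma onb_dirichlet (x t : R) : \sum_(i < n) e i x * e i t = dirichlet m (t - x).
Proof.
have [_ ee span] := onb; have [c cE] := span _ (dirichlet_Trig m x).
rewrite cE; apply: eq_bigr => j _; congr (_ * _).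
rewrite -(dirichlet_reproducing x (eT j)) (L2_prod_lincomb (@ec j) cE).
rewrite (bigD1 j)//= ee eqxx mulr1 big1 ?addr0// => i ij.
by rewrite ee (negbTE ij) mulr0.
Qed.

(** Otherwise 1 and cos would be multiples of one function, although cos separates 0 and [pi]. Two
    coordinates are required by the reduction to the Gaussian plane. *)
Lemma onb_size_gt1 : (0 < m)%N -> (1 < n)%N.
Proof.
move=> m0; have [_ _ span] := onb.
have [c cE] : exists c : 'I_n -> R, forall t, 1 = \sum_(i < n) c i * e i t.
  apply: span; exists 1, (fun=> 0), (fun=> 0) => t.
  by rewrite big1 ?addr0// => k _; rewrite !mul0r addr0.
have [b bE] : exists b : 'I_n -> R, forall t, cos t = \sum_(i < n) b i * e i t.
  apply: span; exists 0, (fun k => (k == 1%N)%:R), (fun=> 0) => t.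
  rewrite add0r (bigD1_seq 1%N)/= ?mem_index_iota ?iota_uniq//.
  rewrite !mul1r mul0r addr0 big1 ?addr0// => k /negbTE ->.
  by rewrite !mul0r addr0.
rewrite ltnNge; apply/negP => n1.
have := cE 0; have := cE pi; have := bE 0; have := bE pi; rewrite cos0 cospi.
have [n0|/eqP n0] := eqVneq n 0%N.
  move=> _ _ _; rewrite big1; first by move/eqP; rewrite oner_eq0.
  by move=> [i ni]; exfalso; move: ni; rewrite n0.
have n_gt0 : (0 < n)%N by rewrite lt0n; apply/eqP.
pose i0 := Ordinal n_gt0.
have only (F : 'I_n -> R) : \sum_(i < n) F i = F i0.
  rewrite (bigD1 i0)//= big1 ?addr0// => i; rewrite -val_eqE/=.
  by rewrite -lt0n => i1; have := leq_trans (ltn_ord i) n1; rewrite ltnS leqNgt i1.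
rewrite !only => bp b0 cp c0.
have c_neq0 : c i0 != 0.
  by apply/eqP => c00; move/eqP: c0; rewrite c00 mul0r oner_eq0.
have ee0 : e i0 pi = e i0 0 by apply: (mulfI c_neq0); rewrite -cp -c0.
by move/eqP: bp; rewrite ee0 -b0 lt_eqF//; lra.
Qed.

(** If all these products vanished, [cos (m t)] would be orthogonal to itself, whereas its squared
    norm is 1/2. This makes the extreme coefficients nondegenerate Gaussian forms. *)
Lemma onb_top_coefficient : (0 < m)%N ->
  0 < dotp (fun i => L2_prod (e i) (fun t => cos (m%:R * t)))
           (fun i => L2_prod (e i) (fun t => cos (m%:R * t))).
Proof.
move=> m0; have [_ _ span] := onb.
have [b bE] : exists b : 'I_n -> R,
    forall t, cos (m%:R * t) = \sum_(i < n) b i * e i t.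
  apply: span; exists 0, (fun k => (k == m)%:R), (fun=> 0) => t.
  rewrite add0r (bigD1_seq m)/= ?mem_index_iota ?iota_uniq ?m0 ?ltnSn//.
  rewrite eqxx !mul1r mul0r addr0 big1 ?addr0// => k /negbTE ->.
  by rewrite !mul0r addr0.
have cc : continuous (fun t : R => cos (m%:R * t)).
  by move=> t; under eq_fun do rewrite -[_ * _]subr0; exact: continuous_wave.
have := L2_prod_lincomb cc bE.
have -> : L2_prod (fun t : R => cos (m%:R * t)) (fun t => cos (m%:R * t)) = 2^-1.
  have := @circle_mean_coscos R m m 0 0; rewrite eqxx addn_eq0 gtn_eqF// mul0r.
  rewrite subr0 cos0 addr0 !mulr1 => <-; congr circle_mean.
  by apply/funext => t; rewrite !subr0.
move=> h; rewrite lt_neqAle sumr_ge0 ?andbT => [|i _]; last exact: sqr_ge0.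
apply: contra_eq_neq h => /esym/psumr_eq0P h0.
rewrite big1 ?invr_eq0 ?pnatr_eq0// => i _.
have /eqP := h0 (fun i _ => sqr_ge0 _) i isT.
by rewrite mulf_eq0 orbb => /eqP ->; rewrite mulr0.
Qed.

End orthonormal_basis.

(** * Local behaviour of trigonometric polynomials *)

Section trig_calculus.
Context {R : realType}.
Implicit Types (g : R -> R).

Lemma ler_norm_sin (x : R) : `|sin x| <= `|x|.
Proof.
wlog x0 : x / 0 <= x.
  move=> h; have [x0|/ltW x0] := leP 0 x; first exact: h.
  by rewrite -normrN -sinN -[leRHS]normrN h// oppr_ge0.
have [|c _] := @MVT_segment R sin cos 0 x x0 (fun y _ => is_derive_sin y).
  by apply: continuous_subspaceT; exact: continuous_sin.
rewrite sin0 !subr0 => ->; rewrite normrM ler_piMl//; exact: cos_max.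
Qed.

Lemma onem_cosE (x : R) : 1 - cos x = 2 * sin (x / 2) ^+ 2.
Proof.
have {1}-> : x = (x / 2) *+ 2 by rewrite -mulr_natr divfK.
by rewrite cos_mulr2n cos2sin2 mulr2n; ring.
Qed.

Lemma onem_cos_le (x : R) : 1 - cos x <= x ^+ 2 / 2.
Proof.
have : sin (x / 2) ^+ 2 <= (x / 2) ^+ 2.
  by rewrite -[leLHS]real_normK ?num_real// -[leRHS]real_normK ?num_real// ler_pXn2r ?nnegrE// ler_norm_sin.
rewrite onem_cosE; lra.
Qed.

Lemma sin_approx (x : R) : `|sin x - x| <= x ^+ 2.
Proof.
wlog x0 : x / 0 <= x.
  move=> h; have [x0|/ltW x0] := leP 0 x; first exact: h.
  by rewrite -normrN opprD -sinN -[leRHS]sqrrN h// oppr_ge0.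
have [|c] := @MVT_segment R (fun x => sin x - x) (fun x => cos x - 1) 0 x x0
  (fun y _ => is_deriveB (is_derive_sin y) (is_derive_id y 1)).
  apply: continuous_subspaceT => y; apply: cvgB; last exact: cvg_id.
  exact: continuous_sin.
rewrite in_itv/= => /andP[c0 cx]; rewrite sin0 !subr0 => ->.
rewrite normrM expr2 (ger0_norm x0) ler_wpM2r//.
rewrite distrC ger0_norm ?subr_ge0 ?cos_le1// onem_cosE.
have : `|sin (c / 2)| <= c / 2 by rewrite (le_trans (ler_norm_sin _)) ?ger0_norm ?divr_ge0.
have := sin_max (c / 2); rewrite -[sin _ ^+ 2]real_normK ?num_real//.
by have := normr_ge0 (sin (c / 2)); move: `|_| => z; nra.
Qed.

Lemma cos_approx (x y : R) : `|cos y - cos x + sin x * (y - x)| <= 2 * (y - x) ^+ 2.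
Proof.
have {1}-> : y = x + (y - x) by rewrite addrC subrK.
move: (y - x) => h; rewrite cosD.
have -> : cos x * cos h - sin x * sin h - cos x + sin x * h =
  - (cos x * (1 - cos h)) - sin x * (sin h - h) by ring.
have h1 : `|cos x * (1 - cos h)| <= h ^+ 2.
  rewrite normrM -[leRHS]mul1r ler_pM ?cos_max//.
  by rewrite ger0_norm ?subr_ge0 ?cos_le1// (le_trans (onem_cos_le _))//; have := sqr_ge0 h; lra.
have h2 : `|sin x * (sin h - h)| <= h ^+ 2.
  by rewrite normrM -[leRHS]mul1r ler_pM ?sin_max// sin_approx.
by rewrite (le_trans (ler_normB _ _))// normrN; lra.
Qed.

(** Here [b] is the derivative at [t]. The remainder bound is global in [s] because [cos_approx] is,
    and both constants add up along the list of waves. *)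
Lemma Trig_taylor m g t : Trig m g -> exists b M, 0 <= M /\
  forall s, `|g s - g t - b * (s - t)| <= M * (s - t) ^+ 2.
Proof.
move=> /Trig_waves[r _ ->]; elim: r => [|x r [b [M [M0 IH]]]].
  exists 0, 0; split => // s.
  by rewrite /waves !big_nil subrr mul0r subr0 normr0 mul0r.
pose k : R := x.1.2%:R; pose a := x.1.1.
exists (b - a * sin (k * t - x.2) * k), (M + 2 * `|a| * k ^+ 2); split.
  by rewrite addr_ge0// !mulr_ge0// sqr_ge0.
move=> s; rewrite /waves !big_cons -/(waves r s) -/(waves r t) -/k -/a.
have := cos_approx (k * t - x.2) (k * s - x.2).
have -> : k * s - x.2 - (k * t - x.2) = k * (s - t) by ring.
set C := _ - _ + _ => hC.
have -> : a * cos (k * s - x.2) + waves r s -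
  (a * cos (k * t - x.2) + waves r t) - (b - a * sin (k * t - x.2) * k) * (s - t)
  = (waves r s - waves r t - b * (s - t)) + a * C by rewrite /C; ring.
rewrite (le_trans (ler_normD _ _))// mulrDl lerD// normrM.
have -> : 2 * `|a| * k ^+ 2 * (s - t) ^+ 2 = `|a| * (2 * (k * (s - t)) ^+ 2).
  by ring.
by rewrite ler_wpM2l.
Qed.

(** The alternative is whether the derivative [b] at [t] vanishes. The constant is rounded up to an
    integer so that tangential zeros are covered by countably many events. *)
Lemma Trig_zero m g t : Trig m g -> g t = 0 ->
  (exists K : nat, forall s, `|g s| <= K%:R * (s - t) ^+ 2) \/
  (exists2 e, 0 < e & forall a b, t - e < a < t -> t < b < t + e -> (g a < 0) != (g b < 0)).
Proof.
move=> gT gt0; have [b [M [M0 h]]] := Trig_taylor t gT.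
have {}h s : `|g s - b * (s - t)| <= M * (s - t) ^+ 2 by have := h s; rewrite gt0 subr0.
have [b0|b0] := eqVneq b 0.
  left; exists (Num.bound M) => s; have := h s; rewrite b0 mul0r subr0 => /le_trans; apply.
  by rewrite ler_wpM2r ?sqr_ge0// ltW// archi_boundP.
(* Within this radius the linear term dominates the remainder [M * (s - t) ^+ 2]; adding 1 keeps the
   denominator positive. *)
right; exists (`|b| / (M + 1)).
  by rewrite divr_gt0 ?normr_gt0// ltr_wpDl.
have e0 s : `|s - t| < `|b| / (M + 1) -> s != t -> 0 < g s * (b * (s - t)).
  rewrite ltr_pdivlMr ?ltr_wpDl// => st sneq.
  have x0 : 0 < `|s - t| by rewrite normr_gt0 subr_eq0.
  have := h s; rewrite -real_normK ?num_real// => hs.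
  have lt1 : M * `|s - t| ^+ 2 < `|b * (s - t)|.
    by rewrite normrM; nra.
  have := le_lt_trans hs lt1; move: (b * _) => c.
  rewrite ltr_norml; case: (ltgtP c 0) => [c0|c0|->]; last by rewrite normr0 oppr0 => /andP[]; lra.
    by rewrite ltr0_norm// => /andP[]; nra.
  by rewrite gtr0_norm// => /andP[]; nra.
move=> x y /andP[x1 x2] /andP[y1 y2].
have hx : 0 < g x * (b * (x - t)).
  by apply: e0; [rewrite ltr0_norm; lra|rewrite lt_eqF].
have hy : 0 < g y * (b * (y - t)).
  by apply: e0; [rewrite gtr0_norm; lra|rewrite gt_eqF].
apply/eqP => gxy.
have gg : 0 <= g x * g y.
  have [gx|gx] := ltP (g x) 0.
    by rewrite mulr_le0// ltW// -gxy.
  by rewrite mulr_ge0// leNgt -gxy -leNgt.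
have := mulr_gt0 hx hy.
rewrite (_ : g x * (b * (x - t)) * (g y * (b * (y - t))) =
  (g x * g y * b ^+ 2) * ((x - t) * (y - t))); last by ring.
apply/negP; rewrite -leNgt (mulr_ge0_le0 (mulr_ge0 gg (sqr_ge0 b)))//.
by rewrite mulr_le0_ge0 ?subr_ge0 ?subr_le0 ?ltW.
Qed.

End trig_calculus.

(** * Correlation angle at small distance *)

Section dirichlet_angle.
Context {R : realType}.

Lemma cos_approx2 (y : R) : `|1 - cos y - y ^+ 2 / 2| <= `|y| ^+ 3.
Proof.
rewrite onem_cosE; set z := y / 2.
have yz : y = 2 * z by rewrite /z; field.
have -> : 2 * sin z ^+ 2 - y ^+ 2 / 2 = (sin z - z) * (2 * (sin z + z)).
  by rewrite yz; field.
have h1 := sin_approx z; have h2 : `|2 * (sin z + z)| <= 4 * `|z|.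
  rewrite normrM ger0_norm// -[4]/(2 * 2)%:R natrM -mulrA ler_wpM2l//.
  rewrite (le_trans (ler_normD _ _))// mulr_natl mulr2n lerD//.
  exact: ler_norm_sin.
rewrite normrM (le_trans (ler_pM _ _ h1 h2))//.
have zz : z ^+ 2 = `|z| ^+ 2 by rewrite real_normK ?num_real.
have yy : `|y| = 2 * `|z| by rewrite yz normrM ger0_norm.
rewrite zz yy; have := exprn_ge0 3 (normr_ge0 z); move: `|z| => u u3.
have -> : u ^+ 2 * (4 * u) = 4 * u ^+ 3 by ring.
have -> : (2 * u) ^+ 3 = 8 * u ^+ 3 by ring.
lra.
Qed.

Lemma sum_sqr m : \sum_(1 <= k < m.+1) (k%:R : R) ^+ 2 =
  m%:R * (m%:R + 1) * (2 * m%:R + 1) / 6.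
Proof.
elim: m => [|m IH]; first by rewrite big_geq// !mul0r.
by rewrite big_nat_recr//= IH -natr1; field.
Qed.

Lemma dirichlet0 m : dirichlet m 0 = 2 * m%:R + 1 :> R.
Proof.
rewrite /dirichlet; under eq_bigr do rewrite mulr0 cos0 mulr1.
by rewrite sumr_const_nat subn1 mulr_natr addrC.
Qed.

Lemma dirichlet_approx m : exists2 C : R, 0 <= C & forall h, 0 <= h ->
  `|dirichlet m 0 - dirichlet m h -
    m%:R * (m%:R + 1) * (2 * m%:R + 1) / 6 * h ^+ 2| <= C * h ^+ 3.
Proof.
exists (\sum_(1 <= k < m.+1) 2 * (k%:R : R) ^+ 3).
  by apply: sumr_ge0 => k _; rewrite mulr_ge0// exprn_ge0.
move=> h h0; rewrite -sum_sqr.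
have -> : dirichlet m 0 - dirichlet m h -
    (\sum_(1 <= k < m.+1) k%:R ^+ 2) * h ^+ 2 =
    \sum_(1 <= k < m.+1) 2 * (1 - cos (k%:R * h) - (k%:R * h) ^+ 2 / 2).
  transitivity (\sum_(1 <= k < m.+1)
      (2 * cos (k%:R * 0) - 2 * cos (k%:R * h) - k%:R ^+ 2 * h ^+ 2)).
    by rewrite !sumrB -mulr_suml /dirichlet; ring.
  by apply: eq_bigr => k _; rewrite mulr0 cos0; field.
rewrite mulr_suml (le_trans (ler_norm_sum _ _ _))//; apply: ler_sum => k _.
have kh0 : 0 <= k%:R * h by rewrite mulr_ge0.
have := cos_approx2 (k%:R * h); rewrite (ger0_norm kh0) [in leRHS]exprMn => hk.
by rewrite normrM ger0_norm// -mulrA ler_wpM2l.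
Qed.

Definition angle m (h : R) : R := acos (dirichlet m h / dirichlet m 0).

Lemma dirichlet0_gt0 m : 0 < dirichlet m 0 :> R.
Proof. by rewrite dirichlet0 ltr_wpDl// mulr_ge0. Qed.

Lemma dirichlet_ratio m (h : R) : -1 <= dirichlet m h / dirichlet m 0 <= 1.
Proof.
rewrite -ler_norml normrM normfV (gtr0_norm (dirichlet0_gt0 m)).
rewrite ler_pdivrMr ?dirichlet0_gt0// mul1r /dirichlet.
rewrite (le_trans (ler_normD _ _))// normr1 lerD2l.
rewrite (le_trans (ler_norm_sum _ _ _))//; apply: ler_sum => k _.
by rewrite mulr0 cos0 mulr1 normrM ger0_norm// ler_piMr// cos_max.
Qed.

Lemma angleK m (h : R) : cos (angle m h) = dirichlet m h / dirichlet m 0.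
Proof. by rewrite /angle acosK// in_itv/=; exact: dirichlet_ratio. Qed.

(** The square root equals [2 * |sin (x / 2)|], the chord of an arc [x]. It turns an expansion of
    the cosine of a small angle into one of the angle, avoiding acos near 1, where it is not
    differentiable. *)
Lemma chord_bounds (x : R) : 0 <= x <= 1 ->
  x * (1 - x / 2) <= Num.sqrt (2 * (1 - cos x)) <= x.
Proof.
move=> /andP[x0 x1]; set q := Num.sqrt _.
have xh : 0 <= x / 2 by rewrite divr_ge0.
have qE : q = 2 * `|sin (x / 2)|.
  rewrite /q onem_cosE (_ : 2 * (2 * sin (x / 2) ^+ 2) = (2 * sin (x / 2)) ^+ 2).
    by rewrite sqrtr_sqr normrM ger0_norm.
  by ring.
apply/andP; split; last first.
  have := ler_norm_sin (x / 2); rewrite [X in _ <= X]ger0_norm// qE; lra.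
have := sin_approx (x / 2); rewrite ler_norml => /andP[h _].
have := ler_norm (sin (x / 2)); rewrite qE => h2.
have : (x / 2) ^+ 2 = x ^+ 2 / 4 by field.
have : x * (1 - x / 2) = x - x ^+ 2 / 2 by field.
lra.
Qed.

Lemma angle_cvg m (h : nat -> R) : (0 < m)%N -> (forall n, 0 < h n) ->
  h n @[n --> \oo] --> (0 : R) ->
  (\forall n \near \oo, 0 <= angle m (h n) <= 1) /\
  angle m (h n) / h n @[n --> \oo] --> Num.sqrt (m%:R * (m%:R + 1) / 3).
Proof.
move=> m0 h0 hcvg.
have [C C0 HC] := @dirichlet_approx m.
set a := m%:R * (m%:R + 1) / 3.
pose D := @dirichlet R m 0.
have D0 : 0 < D := dirichlet0_gt0 m.
have DE : D = 2 * m%:R + 1 by exact: dirichlet0.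
(* The squared chord. In its limit [a] after division by [h n ^+ 2], the factor [2 m + 1] of the sum
   of squares cancels against [D]. *)
pose u n := 2 * (1 - cos (angle m (h n))).
have uE n : `|u n / h n ^+ 2 - a| <= 2 * C / D * h n.
  have hn := h0 n; have hn2 : 0 < h n ^+ 2 by rewrite exprn_gt0.
  have -> : u n / h n ^+ 2 - a = 2 / (D * h n ^+ 2) *
     (D - dirichlet m (h n) -
      m%:R * (m%:R + 1) * (2 * m%:R + 1) / 6 * h n ^+ 2).
    rewrite -DE /u angleK -/D /a; field.
    by rewrite !gt_eqF.
  rewrite normrM ger0_norm; last by rewrite divr_ge0// ltW// mulr_gt0.
  apply: (le_trans (ler_wpM2l _ (HC _ (ltW hn)))).
    by rewrite divr_ge0// ltW// mulr_gt0.
  rewrite le_eqVlt; apply/orP; left; apply/eqP; field.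
  by rewrite !gt_eqF.
have u_cvg : u n / h n ^+ 2 @[n --> \oo] --> a.
  apply/subr_cvg0.
  have b0 : 2 * C / D * h n @[n --> \oo] --> (0 : R).
    by rewrite -[X in _ --> X](mulr0 (2 * C / D)); apply: cvgM => //; exact: cvg_cst.
  apply: (squeeze_cvgr (f := fun n => - (2 * C / D * h n)) (h := fun n => 2 * C / D * h n)) => //.
    by near=> n; rewrite -ler_norml uE.
  by rewrite -oppr0; apply: cvgN.
pose q n := Num.sqrt (u n).
have q_cvg : q n / h n @[n --> \oo] --> Num.sqrt a.
  rewrite (_ : (fun n => q n / h n) = (fun n => Num.sqrt (u n / h n ^+ 2))).
    by apply: (cvg_comp _ _ u_cvg); exact: sqrt_continuous.
  apply/funext => n; rewrite sqrtrM; last by rewrite /u mulr_ge0// subr_ge0 cos_le1.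
  by rewrite sqrtrV ?sqr_ge0// sqrtr_sqr gtr0_norm.
have q0 : q n @[n --> \oo] --> (0 : R).
  rewrite (_ : q = (fun n => q n / h n * h n)).
    by rewrite -[X in _ --> X](mulr0 (Num.sqrt a)); apply: cvgM.
  by apply/funext => n; rewrite divfK// gt_eqF.
have pi1 : 1 <= pi :> R by have := @pi_ge2 R; lra.
have c1 : cos 1 < 1 :> R.
  by rewrite -[ltRHS]cos0 ltr_cos ?in_itv/= ?lexx ?ler01 ?pi_ge0 ?ltr01.
have rat n := @dirichlet_ratio m (h n).
(* Chords increase with the angle on [[0, pi]], so a chord shorter than that of angle 1 forces an
   angle below 1. *)
have small : \forall n \near \oo, 0 <= angle m (h n) <= 1.
  pose eps := Num.sqrt (2 * (1 - cos 1)) : R.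
  have eps0 : 0 < eps by rewrite sqrtr_gt0 mulr_gt0// subr_gt0.
  near=> n; rewrite acos_ge0//= leNgt; apply/negP => gt1.
  have : q n < eps by near: n; exact: cvgr_lt q0 _ eps0.
  rewrite /q /eps ltr_sqrt; last by rewrite mulr_gt0// subr_gt0.
  rewrite /u ltr_pM2l// ltrD2l ltrN2; apply/negP; rewrite -leNgt.
  rewrite ltW// ltr_cos ?in_itv/= ?ler01 ?pi1//.
  by rewrite acos_ge0// acos_lepi.
split => //.
(* For an angle [t <= 1] of chord [q], the bounds give [q <= t] and [t / 2 <= q], hence
   [t (1 - q) <= t (1 - t / 2) <= q]. *)
apply: (squeeze_cvgr (f := fun n => q n / h n) (h := fun n => q n / h n * (1 - q n)^-1)) => //; last first.
  rewrite -[Num.sqrt a]mulr1 -[X in _ * X]invr1; apply: cvgM => //.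
  apply: cvgV; first exact: oner_neq0.
  by rewrite -[X in _ --> X](subr0 1); apply: cvgB => //; exact: cvg_cst.
near=> n.
have /andP[t0 t1] : 0 <= angle m (h n) <= 1 by near: n.
have qh : q n < 2^-1 by near: n; apply: cvgr_lt q0 _ _; rewrite invr_gt0.
have /andP[] : angle m (h n) * (1 - angle m (h n) / 2) <= q n <= angle m (h n).
  by apply: chord_bounds; rewrite t0.
move: (angle m (h n)) (q n) t0 t1 qh => t x t0 t1 xh tx xt.
rewrite ler_pM2r ?invr_gt0// xt/= mulrAC ler_pM2r ?invr_gt0//.
rewrite ler_pdivlMr; last by lra.
have t2 : t / 2 <= x by nra.
have -> : t * (1 - x) = t * (1 - t / 2) + t * (t / 2 - x) by ring.
have : t * (t / 2 - x) <= 0 by rewrite mulr_ge0_le0// subr_le0.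
lra.
Unshelve. all: by end_near. Qed.

End dirichlet_angle.

(** * Sign changes on dyadic grids *)

Section counting_seq.
Context {R : realType}.

Lemma counting_ge (T : choiceType) (A : set T) (s : seq T) : uniq s ->
  (forall x, x \in s -> A x) -> ((size s)%:R%:E <= counting A :> \bar R)%E.
Proof.
move=> us sA; rewrite /counting; case: asboolP => [fA|_]; last exact: leey.
rewrite lee_fin ler_nat; apply: uniq_leq_size => // x /sA Ax.
by rewrite in_fset_set// inE.
Qed.

(** An infinite set contains finite sets of every size, so finite lists also detect the value
    [+oo]. *)
Lemma counting_le (T : choiceType) (A : set T) (x : \bar R) :
  (forall s : seq T, uniq s -> (forall y, y \in s -> A y) ->
    ((size s)%:R%:E <= x)%E) -> (counting A <= x)%E.
Proof.
move=> h; rewrite /counting; case: asboolP => [fA|iA].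
  apply: h; first exact: fset_uniq.
  by move=> y; rewrite in_fset_set// inE.
have {}h n : (n%:R%:E <= x)%E.
  have [B BA Bn] := infinite_set_fset n iA.
  by apply: (le_trans _ (h _ (fset_uniq B) BA)); rewrite lee_fin ler_nat.
case: x h => [r|//|] h.
  have := h (Num.bound `|r|); rewrite lee_fin leNgt => /negP[].
  by rewrite (le_lt_trans (ler_norm r))// archi_boundP.
by have := h 0%N.
Qed.

Lemma counting_inj (T U : choiceType) (A : set T) (B : set U) (f : T -> U) :
  (forall x, A x -> B (f x)) ->
  (forall x y, A x -> A y -> f x = f y -> x = y) ->
  (counting A <= counting B :> \bar R)%E.
Proof.
move=> AB finj; apply: counting_le => s us sA.
rewrite -(size_map f); apply: counting_ge => [|_ /mapP[x /sA /AB Bx ->]//].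
by rewrite map_inj_in_uniq// => x y /sA Ax /sA Ay; exact: finj.
Qed.

End counting_seq.

Section sign_changes.
Context {R : realType}.
Implicit Types (g : R -> R) (h t : R) (n : nat).

(* A value 0 counts as positive, which makes the count nondecreasing under
   refinement with no assumption on [g]. *)
Definition nsign_changes h n g : nat :=
  \sum_(0 <= j < n) ((g (j%:R * h)%R < 0)%R != (g (j.+1%:R * h)%R < 0)%R).

Lemma nsign_changesE h n g : nsign_changes h n g =
  size [seq j <- iota 0 n | (g (j%:R * h) < 0) != (g (j.+1%:R * h) < 0)].
Proof.
by rewrite /nsign_changes size_filter -sumn_count sumnE big_map /index_iota subn0.
Qed.

(** A change across a cell forces a change across one of its two halves. *)
Lemma nsign_changes_refine h n g :
  (nsign_changes h n g <= nsign_changes (h / 2) (2 * n) g)%N.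
Proof.
rewrite /nsign_changes; elim: n => [|n IH]; first by rewrite big_geq.
rewrite mulnS add2n !big_nat_recr//= -addnA leq_add//.
have -> : (2 * n)%:R * (h / 2) = n%:R * h by rewrite natrM; field.
have -> : (2 * n).+2%:R * (h / 2) = n.+1%:R * h by rewrite -!natr1 natrM; field.
by do 3 case: (_ < _).
Qed.

Definition dyadic_step n : R := 2 * pi / 2 ^+ n.
Definition dyadic_changes n g : nat := nsign_changes (dyadic_step n) (2 ^ n) g.
Definition circle_zeros g : set R := [set t | 0 <= t < 2 * pi /\ g t = 0].

Lemma dyadic_step_gt0 n : 0 < dyadic_step n.
Proof. by rewrite divr_gt0 ?mulr_gt0 ?pi_gt0// exprn_gt0. Qed.

Lemma dyadic_step_cvg0 : dyadic_step n @[n --> \oo] --> (0 : R).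
Proof. exact: cvg_div_expr2. Qed.

Lemma dyadic_step_end n : (2 ^ n)%:R * dyadic_step n = 2 * pi.
Proof. by rewrite /dyadic_step natrX mulrCA divff ?mulr1// expf_eq0. Qed.

Lemma nondecreasing_dyadic_changes g :
  {homo (dyadic_changes ^~ g) : n p / (n <= p)%N}.
Proof.
apply: homo_leq => // [|n]; first exact: leq_trans.
rewrite /dyadic_changes expnS (_ : dyadic_step n.+1 = dyadic_step n / 2).
  exact: nsign_changes_refine.
by rewrite /dyadic_step exprSr invfM mulrA.
Qed.

Definition off_grid g :=
  forall n j, (j <= 2 ^ n)%N -> g (j%:R * dyadic_step n) != 0.

(** Derivative-free: of simplicity only the change of sign is kept, which is what a grid detects. *)
Definition simple_zeros g := forall t, circle_zeros g t ->
  exists2 e, 0 < e & forall a b, t - e < a < t -> t < b < t + e ->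
    (g a < 0) != (g b < 0).

(** Every cell with a change contains a zero by the intermediate value theorem. Off the grid it lies
    strictly inside, so distinct cells give distinct zeros. *)
Lemma dyadic_changes_le g n : continuous g -> off_grid g ->
  ((dyadic_changes n g)%:R%:E <= counting (circle_zeros g) :> \bar R)%E.
Proof.
move=> cg og; set h := dyadic_step n; have h0 : 0 < h := dyadic_step_gt0 n.
have zero j : {t | (j < 2 ^ n)%N -> (g (j%:R * h) < 0) != (g (j.+1%:R * h) < 0) ->
    j%:R * h < t < j.+1%:R * h /\ g t = 0}.
  apply: cid; have [jn|] := ltnP j (2 ^ n)%N; last by exists 0.
  have [ch|/negP nch] := boolP ((g (j%:R * h) < 0) != (g (j.+1%:R * h) < 0)); last by exists 0.
  have jj : j%:R * h <= j.+1%:R * h by rewrite ler_pM2r// ler_nat.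
  have g1 := og n j (ltnW jn); have g2 := og n j.+1 jn.
  have [||t tI gt0] := @IVT R g (j%:R * h) (j.+1%:R * h) 0 jj.
  - exact: continuous_subspaceT.
  - move: ch; rewrite ge_min le_max.
    have [l1|l1] := ltP (g (j%:R * h)) 0; have [l2|l2] := ltP (g (j.+1%:R * h)) 0 => // _.
      by rewrite (ltW l1) orbT.
    by rewrite (ltW l2) orbT.
  exists t => _ _; split => //; move: tI; rewrite in_itv/= => /andP[t1 t2].
  rewrite !lt_neqAle t1 t2 !andbT; apply/andP; split.
    by apply: contraNneq g1 => ->; apply/eqP.
  by apply: contraNneq g2 => <-; apply/eqP.
rewrite /dyadic_changes nsign_changesE -(size_map (fun j => sval (zero j))).
have zP j : j \in [seq j <- iota 0 (2 ^ n) |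
     (g (j%:R * h) < 0) != (g (j.+1%:R * h) < 0)] ->
    j%:R * h < sval (zero j) < j.+1%:R * h /\ g (sval (zero j)) = 0 /\ (j < 2 ^ n)%N.
  rewrite mem_filter mem_iota add0n => /andP[ch jn].
  by case: (zero j) => t /= /(_ jn ch)[].
apply: counting_ge.
  rewrite map_inj_in_uniq ?filter_uniq ?iota_uniq// => j k.
  move=> /zP[/andP[j1 j2] _] /zP[/andP[k1 k2] _] jk.
  have : j%:R * h < k.+1%:R * h by rewrite (lt_trans j1)// jk.
  have : k%:R * h < j.+1%:R * h by rewrite (lt_trans k1)// -jk.
  rewrite !ltr_pM2r// !ltr_nat !ltnS => kj jk'.
  by apply/eqP; rewrite eqn_leq kj jk'.
move=> _ /mapP[j /zP[/andP[t1 t2] [gt0 jn]] ->]; split => //.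
apply/andP; split; first by rewrite (le_trans _ (ltW t1))// mulr_ge0// ltW.
by rewrite (lt_le_trans t2)// -(dyadic_step_end n) ler_pM2r// ler_nat.
Qed.

Lemma near_all (I : eqType) (s : seq I) (P : I -> nat -> Prop) :
  (forall i, i \in s -> \forall n \near \oo, P i n) ->
  \forall n \near \oo, forall i, i \in s -> P i n.
Proof.
elim: s => [|i s IH] h; first by near=> n.
have hi := h i (mem_head _ _).
have hs : \forall n \near \oo, forall j, j \in s -> P j n.
  by apply: IH => j js; apply: h; rewrite inE js orbT.
near=> n => j; rewrite inE => /predU1P[->|js]; first by near: n.
by move: j js; near: n.
Unshelve. all: by end_near. Qed.

(** Once the step is below all gaps between the zeros and all radii [e], the zeros occupy distinct
    cells, and the ends of each cell lie on both sides of its zero within the radius. *)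
Lemma dyadic_changes_ge g (s : seq R) : off_grid g -> simple_zeros g ->
  uniq s -> (forall t, t \in s -> circle_zeros g t) ->
  exists n, (size s <= dyadic_changes n g)%N.
Proof.
move=> og sz us sZ.
have near_lt (x : R) : 0 < x -> \forall n \near \oo, dyadic_step n < x.
  by move=> x0; apply: cvgr_lt dyadic_step_cvg0 _ x0.
have e_ t : {e | t \in s -> 0 < e /\ forall a b, t - e < a < t -> t < b < t + e ->
    (g a < 0) != (g b < 0)}.
  apply: cid; have [ts|] := boolP (t \in s); last by exists 0.
  by have [e e0 he] := sz t (sZ t ts); exists e.
have N1 : \forall n \near \oo, forall t, t \in s -> dyadic_step n < sval (e_ t).
  by apply: near_all => t ts; apply: near_lt; case: (e_ t) => e /= /(_ ts)[].
have N2 : \forall n \near \oo, forall t, t \in s -> forall u, u \in s ->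
    t != u -> dyadic_step n < `|t - u|.
  apply: near_all => t ts; apply: near_all => u usu.
  have [tu|tu] := eqVneq t u; first by near=> n.
  have : \forall n \near \oo, dyadic_step n < `|t - u|.
    by apply: near_lt; rewrite normr_gt0 subr_eq0.
  by apply: filterS => n hn _.
have [n [hn1 hn2]] : exists n, (forall t, t \in s -> dyadic_step n < sval (e_ t)) /\
   (forall t, t \in s -> forall u, u \in s -> t != u -> dyadic_step n < `|t - u|).
  apply: (@filter_ex _ (\oo : set_system nat)).
  by apply: filterS2 N1 N2 => n; split.
exists n; rewrite /dyadic_changes nsign_changesE.
have h0 : 0 < dyadic_step n := dyadic_step_gt0 n.
set h := dyadic_step n in hn1 hn2 h0 *.
pose cell t := Num.truncn (t / h).
have cellP t : t \in s -> [/\ (cell t < 2 ^ n)%N, (cell t)%:R * h < t &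
    t < (cell t).+1%:R * h].
  move=> /sZ[/andP[t0 tpi] gt0].
  have /andP[c1 c2] := @truncn_itv _ (t / h) (divr_ge0 t0 (ltW h0)).
  rewrite ler_pdivlMr// in c1; rewrite ltr_pdivrMr// in c2.
  have cn : (cell t < 2 ^ n)%N.
    rewrite -(ltr_nat R) -(ltr_pM2r h0) dyadic_step_end.
    exact: le_lt_trans c1 tpi.
  (* The truncation gives a weak inequality; it is strict because no grid point is a zero. *)
  split => //; rewrite lt_neqAle c1 andbT; apply/eqP => ct.
  by have := og n (cell t) (ltnW cn); rewrite -/h ct gt0 eqxx.
rewrite -(size_map cell); apply: uniq_leq_size.
  rewrite map_inj_in_uniq// => t u ts usu tu; apply/eqP/negP => /negP tnu.
  have := hn2 t ts u usu tnu; have [_ t1 t2] := cellP t ts.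
  have [_ u1 u2] := cellP u usu; move: t1 t2 u1 u2; rewrite tu -!natr1 mulrDl mul1r.
  set c := _ * h => t1 t2 u1 u2; rewrite ltNge ler_norml; apply/negP; rewrite negbK.
  by apply/andP; split; lra.
move=> _ /mapP[t ts ->]; have [cn t1 t2] := cellP t ts.
rewrite mem_filter mem_iota/= add0n cn andbT.
have := hn1 t ts; case: (e_ t) => e /= /(_ ts)[e0 he] he2.
move: t2; rewrite -natr1 mulrDl mul1r => t2.
by apply: he; apply/andP; split; lra.
Unshelve. all: by end_near. Qed.

Lemma dyadic_changes_cvg g : continuous g -> off_grid g -> simple_zeros g ->
  (dyadic_changes n g)%:R%:E @[n --> \oo] --> (counting (circle_zeros g) : \bar R).
Proof.
move=> cg og sz.
have nd : nondecreasing_seq (fun n => (dyadic_changes n g)%:R%:E : \bar R).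
  move=> n p np; rewrite lee_fin ler_nat; exact: nondecreasing_dyadic_changes.
rewrite (_ : counting _ = ereal_sup (range (fun n => (dyadic_changes n g)%:R%:E))).
  exact: ereal_nondecreasing_cvgn.
apply/eqP; rewrite eq_le; apply/andP; split.
  apply: counting_le => s us sZ; have [n sn] := dyadic_changes_ge og sz us sZ.
  apply: (@le_trans _ _ (dyadic_changes n g)%:R%:E).
    by rewrite lee_fin ler_nat.
  by apply: ereal_sup_ubound; exists n.
apply: ge_ereal_sup => _ [n _ <-]; exact: dyadic_changes_le.
Qed.

End sign_changes.

(** * Laurent polynomials on the unit circle *)

Section laurent.
Context {R : realType}.
Local Notation C := R[i].
Implicit Types (a : laurent R) (m : nat) (t : R).

Definition expi t : C := Complex (cos t) (sin t).

Lemma expiD t u : expi (t + u) = expi t * expi u.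
Proof.
by apply/eqP; rewrite eq_complex/= cosD sinD eqxx/= addrC.
Qed.

Lemma expiX t n : expi t ^+ n = expi (n%:R * t).
Proof.
elim: n => [|n IH].
  by apply/eqP; rewrite expr0 mul0r eq_complex/= cos0 sin0 !eqxx.
by rewrite exprS IH -expiD -natr1 mulrDl mul1r addrC.
Qed.

Lemma norm_expi t : `|expi t| = 1.
Proof. by rewrite normc_def/= cos2Dsin2 sqrtr1. Qed.

Lemma expi_neq0 t : expi t != 0.
Proof. by rewrite -normr_eq0 norm_expi oner_neq0. Qed.

Lemma expi_inj t u : 0 <= t < 2 * pi -> 0 <= u < 2 * pi ->
  expi t = expi u -> t = u.
Proof.
wlog ut : t u / u <= t.
  move=> h t1 u1 e; have /orP[ut|tu] := le_total u t; first exact: h.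
  by apply/esym/h.
move=> /andP[t0 tpi] /andP[u0 upi] [ct st].
have : cos (t - u) = 1 by rewrite cosB ct st -!expr2 cos2Dsin2.
move=> c1; have := onem_cosE (t - u); rewrite c1 subrr => /esym/eqP.
rewrite mulf_eq0 pnatr_eq0/= sqrf_eq0 => /eqP s0.
apply/eqP/negP => /negP tu.
have {}ut : u < t by rewrite lt_neqAle ut eq_sym tu.
have : 0 < sin ((t - u) / 2) by apply: sin_gt0_pi; apply/andP; split; lra.
by rewrite s0 ltxx.
Qed.

Lemma expi_surj (z : C) : `|z| = 1 -> exists2 t, 0 <= t < 2 * pi & expi t = z.
Proof.
case: z => x y; rewrite normc_def/= => /complexI r1.
have xy : x ^+ 2 + y ^+ 2 = 1.
  by rewrite -[LHS]sqr_sqrtr ?addr_ge0 ?sqr_ge0// r1 expr1n.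
have x1 : -1 <= x <= 1.
  by rewrite -ler_norml -(@ler_pXn2r _ 2)// ?nnegrE// expr1n real_normK ?num_real//; have := sqr_ge0 y; lra.
have pi0 := @pi_gt0 R; have a0 := acos_ge0 x1; have api := acos_lepi x1.
have cx : cos (acos x) = x by rewrite acosK// in_itv.
have sx : sin (acos x) = `|y|.
  by rewrite sin_acos// -sqrtr_sqr; congr Num.sqrt; lra.
have [y0|y0] := leP 0 y.
  exists (acos x); first by apply/andP; split => //; lra.
  by rewrite /expi cx sx ger0_norm.
have x11 : x < 1.
  have : 0 < y ^+ 2 by rewrite exprn_even_gt0//= lt_eqF.
  by nra.
have a1 : 0 < acos x by apply: acos_gt0; rewrite x11 andbT; case/andP: x1.
exists (2 * pi - acos x); first by apply/andP; split; lra.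
rewrite /expi (_ : 2 * pi - acos x = - acos x + pi *+ 2); last first.
  by rewrite addrC mulr_natl.
by rewrite cosD2pi sinD2pi cosN sinN cx sx ltr0_norm// opprK.
Qed.

Lemma laurent_deg_le a (k : int) m : (laurent_deg a <= m)%N -> (m < `|k|)%N -> a k = 0.
Proof.
move=> am mk; apply/eqP/negP => /negP ak.
have : k \in finsupp a by rewrite mem_finsupp.
move=> ks; have h : (`|k| <= laurent_deg a)%N.
  exact: (@leq_bigmax_seq _ _ xpredT (fun k : int => `|k|%N) k ks isT).
by have := leq_ltn_trans (leq_trans h am) mk; rewrite ltnn.
Qed.

(** Stated for any [m] bounding the degree, since for the random polynomial equality is only almost
    sure. *)
Lemma laurent_eval_shift a m (z : C) : (laurent_deg a <= m)%N -> z != 0 ->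
  z ^+ m * laurent_eval a z =
  \sum_(0 <= j < (2 * m).+1) a (j%:Z - m%:Z) * z ^+ j.
Proof.
move=> am z0; pose sh (j : nat) := j%:Z - m%:Z.
have shI : injective sh by move=> i j /addIr [].
pose s := [seq sh j | j <- index_iota 0 (2 * m).+1].
have us : uniq s by rewrite map_inj_uniq ?iota_uniq.
have sub (k : int) : k \in finsupp a -> k \in s.
  move=> ks; have km : (`|k| <= m)%N.
    by rewrite leqNgt; apply/negP => /(laurent_deg_le am)/eqP; move: ks; rewrite mem_finsupp => /negbTE ->.
  apply/mapP; exists (absz (k + m%:Z)%R).
    by rewrite mem_index_iota/=; lia.
  by rewrite /sh; lia.
transitivity (\sum_(k <- s) z ^+ m * (a k * z ^ k)).
  rewrite /laurent_eval mulr_sumr.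
  rewrite -[RHS](big_rmcond_in (fun k => k \in finsupp a)); last first.
    by move=> k _ /fsfun_dflt ->; rewrite mul0r mulr0.
  rewrite -big_filter; apply: perm_big; apply: uniq_perm.
  - exact: fset_uniq.
  - exact: filter_uniq.
  - by move=> k; rewrite mem_filter; case: (boolP (k \in finsupp a)) => //= /sub ->.
rewrite big_map; apply: eq_bigr => j _; rewrite mulrCA !exprnP -expfzDr//.
by rewrite /sh subrKC.
Qed.

Lemma real_laurent_expi a t : real_laurent a ->
  laurent_eval a (expi t) = (circle_restr a t)%:C%C.
Proof. by move=> ra; rewrite /circle_restr RRe_real// ra//; exact: norm_expi. Qed.

Lemma nreal_roots_circle a : real_laurent a ->
  nreal_roots a = counting (circle_zeros (circle_restr a)).
Proof.
move=> ra; apply/eqP; rewrite eq_le; apply/andP; split.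
  pose arg z := xget 0 [set t | 0 <= t < 2 * pi /\ expi t = z].
  have argP z : `|z| = 1 -> 0 <= arg z < 2 * pi /\ expi (arg z) = z.
    move=> z1; have [t t1 t2] := expi_surj z1.
    by rewrite /arg; case: xgetP => [? -> //|/(_ t)[]].
  apply: (@counting_inj _ _ _ _ _ arg) => [z [[z0 az] z1]|z w [_ z1] [_ w1] zw].
    have [h1 h2] := argP z z1; split => //.
    by rewrite /circle_restr -/(expi (arg z)) h2 az.
  by have [_ <-] := argP z z1; have [_ <-] := argP w w1; rewrite zw.
apply: (@counting_inj _ _ _ _ _ expi) => [t [_ gt0]|t u [t1 _] [u1 _]].
  split; last exact: norm_expi.
  by split; [exact: expi_neq0|rewrite real_laurent_expi// gt0].
exact: expi_inj.
Qed.

End laurent.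

(** * Extreme coefficients and the number of all roots *)

Section laurent_degree.
Context {R : realType}.
Local Notation C := R[i].
Implicit Types (a : laurent R) (m : nat) (t : R).

Lemma ReIm_mul_expi (c : C) t :
  (complex.Re (c * expi t) = complex.Re c * cos t - complex.Im c * sin t) *
  (complex.Im (c * expi t) = complex.Re c * sin t + complex.Im c * cos t).
Proof. by case: c => x y /=. Qed.

Lemma Re_sum (I : Type) (r : seq I) (F : I -> C) :
  complex.Re (\sum_(i <- r) F i) = \sum_(i <- r) complex.Re (F i).
Proof. by elim/big_rec2: _ => // i x y _ <-; case: (F i) y => [? ?] []. Qed.

Lemma Im_sum (I : Type) (r : seq I) (F : I -> C) :
  complex.Im (\sum_(i <- r) F i) = \sum_(i <- r) complex.Im (F i).
Proof. by elim/big_rec2: _ => // i x y _ <-; case: (F i) y => [? ?] []. Qed.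

(** Real and imaginary parts of [z ^ m * a(z) = circle_restr a t * expi (m t)] at [z = expi t]. *)
Lemma circle_restr_shift a m t : real_laurent a -> (laurent_deg a <= m)%N ->
  (\sum_(0 <= j < (2 * m).+1) (complex.Re (a (j%:Z - m%:Z)) * cos (j%:R * t)
     - complex.Im (a (j%:Z - m%:Z)) * sin (j%:R * t))
   = circle_restr a t * cos (m%:R * t)) /\
  (\sum_(0 <= j < (2 * m).+1) (complex.Re (a (j%:Z - m%:Z)) * sin (j%:R * t)
     + complex.Im (a (j%:Z - m%:Z)) * cos (j%:R * t))
   = circle_restr a t * sin (m%:R * t)).
Proof.
move=> ra am; have := laurent_eval_shift am (expi_neq0 t).
rewrite real_laurent_expi// expiX mulrC => e; split.
  move/(congr1 (@complex.Re R)): e; rewrite Re_sum ReIm_mul_expi/= mul0r subr0 => ->.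
  by apply: eq_bigr => j _; rewrite expiX ReIm_mul_expi.
move/(congr1 (@complex.Im R)): e; rewrite Im_sum ReIm_mul_expi/= mul0r addr0 => ->.
by apply: eq_bigr => j _; rewrite expiX ReIm_mul_expi.
Qed.

(** The phase [al = 0] extracts the cosine coefficient, [al = pi / 2] the sine coefficient. The last
    term corrects frequency 0, where the squared cosine has mean 1 instead of 1/2. *)
Lemma circle_mean_trig_sum (p q : nat -> R) (N l : nat) (al : R) : (l < N)%N ->
  circle_mean (fun t => (\sum_(0 <= j < N)
     (p j * cos (j%:R * t) + q j * sin (j%:R * t))) * cos (l%:R * t - al)) =
  2^-1 * (p l * cos al + q l * sin al) +
    (l == 0%N)%:R * (2^-1 * (p l * cos al - q l * sin al)).
Proof.
move=> lN.
have cw b j : continuous (fun t : R => cos (j%:R * t - b) * cos (l%:R * t - al)).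
  by move=> t; apply: cvgM; exact: continuous_wave.
have cM c b j : continuous (fun t : R => c * (cos (j%:R * t - b) * cos (l%:R * t - al))).
  by move=> t; apply: cvgM; [exact: cvg_cst|exact: cw].
transitivity (circle_mean (fun t => \sum_(0 <= j < N)
   (p j * (cos (j%:R * t - 0) * cos (l%:R * t - al)) +
    q j * (cos (j%:R * t - pi / 2) * cos (l%:R * t - al))))).
  congr circle_mean; apply/funext => t; rewrite mulr_suml.
  by apply: eq_bigr => j _; rewrite subr0 cosBpihalf; ring.
rewrite circle_mean_sum; last first.
  by move=> j t; apply: cvgD; exact: cM.
under eq_bigr do rewrite circle_meanD ?circle_meanZ ?circle_mean_coscos//.
rewrite (bigD1_seq l)/= ?mem_index_iota ?iota_uniq// big1 ?addr0.
  rewrite eqxx addn_eq0 andbb !mul1r sub0r cosN add0r (addrC (pi / 2) al).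
  rewrite -[pi / 2 - al]opprB cosN cosBpihalf cosDpihalf; ring.
move=> j jl; rewrite (negbTE jl) addn_eq0.
have -> : (j == 0%N) && (l == 0%N) = false.
  by apply: contra_neqF jl => /andP[/eqP -> /eqP ->].
by rewrite !mul0r addr0 !mulr0 addr0.
Qed.

(* On the circle [z ^ m * a(z)] is a polynomial in [z] equal to
   [circle_restr a t * expi (m t)]; the two coefficients are its Fourier
   coefficients of frequencies [0] and [2 m]. *)
Lemma extreme_coef a m : (0 < m)%N -> real_laurent a -> (laurent_deg a <= m)%N ->
  continuous (circle_restr a) ->
  complex.Re (a (- m%:Z)) = L2_prod (circle_restr a) (fun t => cos (m%:R * t)) /\
  complex.Re (a m%:Z) = L2_prod (circle_restr a) (fun t => cos (m%:R * t)).
Proof.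
move=> m0 ra am cg; set g := circle_restr a.
pose x j := complex.Re (a (j%:Z - m%:Z)); pose y j := complex.Im (a (j%:Z - m%:Z)).
have cosE t : \sum_(0 <= j < (2 * m).+1) (x j * cos (j%:R * t)
     + (- y j) * sin (j%:R * t)) = g t * cos (m%:R * t).
  have [<- _] := circle_restr_shift t ra am.
  by apply: eq_bigr => j _; rewrite mulNr.
have sinE t : \sum_(0 <= j < (2 * m).+1) (y j * cos (j%:R * t)
     + x j * sin (j%:R * t)) = g t * sin (m%:R * t).
  have [_ <-] := circle_restr_shift t ra am.
  by apply: eq_bigr => j _; rewrite addrC.
split.
  have := @circle_mean_trig_sum x (fun j => - y j) (2 * m).+1 0 0 isT.
  under [X in circle_mean X]eq_fun do rewrite cosE mul0r subr0 cos0 mulr1.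
  rewrite eqxx cos0 sin0 !mulr0 !mulr1 addr0 subr0 mul1r -mulrDr.
  rewrite -[L2_prod _ _]/(circle_mean _) => ->.
  by rewrite /x sub0r; field.
have c2 (k : nat) b : continuous (fun t : R => cos (k%:R * t - b)).
  exact: continuous_wave.
have h1 := @circle_mean_trig_sum x (fun j => - y j) _ (2 * m) 0 (ltnSn _).
have h2 := @circle_mean_trig_sum y x _ (2 * m) (pi / 2) (ltnSn _).
have m20 : (2 * m == 0)%N = false by rewrite muln_eq0/= gtn_eqF.
move: h1 h2; rewrite m20 cos0 sin0 cos_pihalf sin_pihalf.
rewrite !mul0r !addr0 !mulr0 !mulr1 add0r addr0 => h1 h2.
(* One half comes from the cosine mean of the real part, the other from the sine mean of the
   imaginary part; they recombine by [cos (m t) cos (2 m t) + sin (m t) sin (2 m t) = cos (m t)]. *)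
transitivity (2^-1 * x (2 * m)%N + 2^-1 * x (2 * m)%N).
  rewrite -mulrDl (_ : 2^-1 + 2^-1 = 1) ?mul1r; last by field.
  by rewrite /x; congr (complex.Re (a _)); lia.
have cgm : continuous (fun t : R => g t * cos (m%:R * t - 0)).
  by move=> t; apply: cvgM; [exact: cg|exact: c2].
have cgs : continuous (fun t : R => g t * cos (m%:R * t - pi / 2)).
  by move=> t; apply: cvgM; [exact: cg|exact: c2].
have e1 : (fun t => (\sum_(0 <= j < (2 * m).+1) (x j * cos (j%:R * t)
     + (- y j) * sin (j%:R * t))) * cos ((2 * m)%:R * t - 0)) =
    (fun t => g t * cos (m%:R * t - 0) * cos ((2 * m)%:R * t - 0)).
  by apply/funext => t; rewrite cosE !subr0.
have e2 : (fun t => (\sum_(0 <= j < (2 * m).+1) (y j * cos (j%:R * t)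
     + x j * sin (j%:R * t))) * cos ((2 * m)%:R * t - pi / 2)) =
    (fun t => g t * cos (m%:R * t - pi / 2) * cos ((2 * m)%:R * t - pi / 2)).
  by apply/funext => t; rewrite sinE [in RHS]cosBpihalf.
rewrite -{1}h1 -h2 e1 e2 -circle_meanD.
- congr circle_mean; apply/funext => t; rewrite !cosBpihalf !subr0.
  rewrite -!mulrA -mulrDr -cosB -cosN; congr (_ * cos _).
  by rewrite natrM; ring.
- by move=> t; apply: cvgM; [exact: cgm|exact: c2].
- by move=> t; apply: cvgM; [exact: cgs|exact: c2].
Qed.

(** The top coefficient gives the numerator degree [2 m]; the bottom one keeps 0 from being a root,
    so its roots are exactly those of [a], and it splits over the complex numbers. *)
Lemma nroots_eq a m : laurent_deg a = m -> a m%:Z != 0 -> a (- m%:Z) != 0 ->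
  nroots a = (2 * m)%N.
Proof.
move=> am a1 a2; set p := laurent_numer a.
have pE : p = \poly_(j < (2 * m).+1) a (j%:Z - m%:Z) by rewrite /p /laurent_numer am.
have top : (2 * m)%N%:Z - m%:Z = m%:Z by lia.
have sp : size p = (2 * m).+1 by rewrite pE size_poly_eq//= top.
have p0 : p`_0 != 0 by rewrite pE coef_poly/= sub0r.
have pn0 : p != 0 by rewrite -size_poly_gt0 sp.
have rootE (z : C) : z != 0 -> (laurent_eval a z == 0) = root p z.
  move=> z0; have := @laurent_eval_shift R a m z; rewrite am leqnn => /(_ isT z0) e.
  rewrite rootE pE horner_poly -(big_mkord xpredT (fun j => a (j%:Z - m%:Z) * z ^+ j)) -e.
  by rewrite mulf_eq0 expf_eq0 (negbTE z0) andbF.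
have [r rE] := closed_field_poly_normal p.
have lc : lead_coef p != 0 by rewrite lead_coef_eq0.
have rootr z : root p z = (z \in r).
  by rewrite rE rootZ// root_prod_XsubC.
have -> : nroots a = \sum_(z \in [set` undup r]) count_mem z r.
  rewrite /nroots (_ : Defs.roots a = [set` undup r]).
    apply: eq_fsbigr => z _; rewrite /root_mult -/p rE -mul_polyC.
    by rewrite mupMr ?mu_prod_XsubC// rootC.
  apply/seteqP; split => z /=; rewrite mem_undup -rootr.
    by move=> [z0 az]; rewrite -rootE// az.
  move=> pz; have z0 : z != 0.
    by apply: contraTneq pz => ->; rewrite /root horner_coef0.
  by split => //; apply/eqP; rewrite rootE.
rewrite -fsbig_seq ?undup_uniq//.
(* Multiplicities become iterated sums of ones, so that summing over the distinct roots gives the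
   length of [r]. *)
transitivity (\sum_(z <- undup r) iterop (count_mem z r) addn 1%N 0%N)%N.
  apply: eq_bigr => z _; rewrite Monoid.iteropE.
  by elim: (count_mem z r) => // n; rewrite iterS => <-.
rewrite big_undup_iterop_count sum1_size.
have := congr1 (fun q : {poly C} => size q) rE.
by rewrite size_scale// size_prod_XsubC sp => -[].
Qed.

End laurent_degree.

(** * Random trigonometric polynomials *)

Section negligible_integral.
Context {R : realType} d (T : measurableType d) (P : {measure set T -> \bar R}).
Local Open Scope ereal_scope.
Import HBNNSimple.

Lemma negligible_small (B : set T) (c : R) :
  (forall n : nat, exists A, [/\ measurable A, B `<=` A & P A <= (c / 2 ^+ n)%:E]) ->
  P.-negligible B.
Proof.
move=> h; pose A n := sval (cid (h n)).
have AP n : [/\ measurable (A n), B `<=` A n & P (A n) <= (c / 2 ^+ n)%:E].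
  by rewrite /A; case: cid.
exists (\bigcap_n A n); split.
- by apply: bigcapT_measurable => n; case: (AP n).
- apply/eqP; rewrite -measure_le0; apply/lee_addgt0Pr => e e0; rewrite add0e.
  have [n cn] : exists n, (c / 2 ^+ n < e)%R.
    by apply: (@filter_ex _ (\oo : set_system nat)); apply: cvgr_lt (cvg_div_expr2 c) _ e0.
  have [mA _ PA] := AP n.
  apply: le_trans (ltW (_ : (c / 2 ^+ n)%:E < e%:E)); last by rewrite lte_fin.
  apply: le_trans PA; apply: le_measure; rewrite ?inE//.
    by apply: bigcapT_measurable => k; case: (AP k).
  exact: bigcap_inf.
- by move=> w Bw n _; have [_ /(_ _ Bw)] := AP n.
Qed.

(** The integral is a supremum over simple functions below [F]; setting such a function to 0 on [N]
    keeps its integral and puts it below [G]. *)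
Let le_nnintegral_ae (F G : T -> \bar R) (N : set T) :
  measurable N -> P N = 0 -> (forall w, 0 <= F w) -> (forall w, 0 <= G w) ->
  (forall w, ~ N w -> F w = G w) -> \int[P]_w F w <= \int[P]_w G w.
Proof.
move=> mN N0 F0 G0 FG; rewrite !ge0_integralTE//.
apply: ge_ereal_sup => _ [h hF <-].
have mNC := measurableC mN.
pose h' := proj_nnsfun h mNC.
have -> : sintegral P h = sintegral P h'.
  rewrite -!integralT_nnsfun; apply: ge0_ae_eq_integral => //.
  - by apply/measurable_EFinP; exact: measurable_funP.
  - by apply/measurable_EFinP; exact: measurable_funP.
  - by move=> w _; rewrite lee_fin.
  - by move=> w _; rewrite lee_fin.
  exists N; split => // w /=; apply: contra_notP => Nw _.
  by rewrite /h'/= mindicE mem_set// mulr1.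
apply: ereal_sup_ubound; exists h' => //= w.
rewrite mindicE; have [Nw|Nw] := pselect (N w).
  by rewrite memNset ?mulr0//= => /(_ Nw).
by rewrite mem_set// mulr1 -FG.
Qed.

(* No measurability is assumed: the number of real roots is only shown to agree
   almost everywhere with a measurable function, and [P] need not be complete. *)
Lemma ge0_integral_ae_eq (F G : T -> \bar R) :
  (forall w, 0 <= F w) -> (forall w, 0 <= G w) ->
  P.-negligible [set w | F w <> G w] -> \int[P]_w F w = \int[P]_w G w.
Proof.
move=> F0 G0 [N [mN N0 FGN]]; apply/eqP; rewrite eq_le; apply/andP; split;
  by apply: (le_nnintegral_ae mN) => // w Nw; apply: contrapT => FG;
     apply: Nw; apply: FGN => //= e; exact/FG/esym.
Qed.

End negligible_integral.

Section gaussian_trig.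
Context {R : realType} d (T : measurableType d) (P : probability T R).
Variables (m n : nat) (e : 'I_n -> R -> R) (X : 'I_n -> T -> measurableTypeR R).
Hypotheses (onb : Trig_orthonormal_basis m e) (gX : gaussian_family P X).

Let D0 : R := dirichlet m 0.
Let D0_gt0 : 0 < D0. Proof. exact: dirichlet0_gt0. Qed.

Definition random_trig w (t : R) : R := dotp (X ^~ w) (e ^~ t).
Local Notation g := random_trig.

Let dotp_e t : dotp (e ^~ t) (e ^~ t) = D0.
Proof. by rewrite /dotp (onb_dirichlet onb) subrr. Qed.

Lemma random_trig_Trig w : Trig m (g w).
Proof.
have [eT _ _] := onb.
pose a0 i := sval (cid (eT i)).
have h1 i := svalP (cid (eT i)); pose al i := sval (cid (h1 i)).
have h2 i := svalP (cid (h1 i)); pose be i := sval (cid (h2 i)).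
have eE i : forall t, e i t = a0 i + \sum_(1 <= k < m.+1)
   (al i k * cos (k%:R * t) + be i k * sin (k%:R * t)) := svalP (cid (h2 i)).
exists (\sum_i X i w * a0 i), (fun k => \sum_i X i w * al i k),
  (fun k => \sum_i X i w * be i k) => t.
rewrite /random_trig /dotp; under eq_bigr do rewrite eE mulrDr.
rewrite big_split/=; congr (_ + _).
under eq_bigr do rewrite mulr_sumr; rewrite exchange_big/=.
apply: eq_bigr => k _; rewrite !mulr_suml -big_split/=.
by apply: eq_bigr => i _; rewrite mulrDr !mulrA.
Qed.

Lemma measurable_random_trig t : measurable_fun setT (g ^~ t).
Proof. exact: measurable_dotp gX. Qed.

Lemma measurable_random_trig_le t c : measurable [set w | `|g w t| <= c].
Proof. exact: measurable_normr_le (measurable_random_trig t). Qed.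

Let c0 := 2 * normal_peak 1 / Num.sqrt D0.

(** The variance of [g w t] is [D0] at every [t], so one constant serves all grid points. *)
Let random_trig_small t c : 0 <= c ->
  (P [set w | (`|g w t| <= c)%R] <= (c0 * c)%:E)%E.
Proof.
by move=> hc; have := @gaussian_small_ball _ _ _ P _ X (e ^~ t) c gX; rewrite dotp_e; apply.
Qed.

Lemma random_trig_off_grid : P.-negligible [set w | ~ off_grid (g w)].
Proof.
apply: (@negligibleS _ _ _ _ (\bigcup_k \bigcup_j
    [set w | g w (j%:R * dyadic_step k) = 0])).
  move=> w /= /existsNP[k /existsNP[j]] /not_implyP[jk /negP]; rewrite negbK => /eqP h.
  by exists k => //; exists j.
apply: negligible_bigcup => k; apply: negligible_bigcup => j.
apply: (@negligible_small _ _ _ _ _ c0) => l.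
exists [set w | `|g w (j%:R * dyadic_step k)| <= (2 ^+ l)^-1]; split.
- exact: measurable_random_trig_le.
- by move=> w /= ->; rewrite normr0 invr_ge0 exprn_ge0.
- by apply: random_trig_small; rewrite invr_ge0 exprn_ge0.
Qed.

(* At a tangential zero, [|g| <= K h ^ 2] at the neighbouring point of the grid of
   step [h]; each of the O(1 / h) grid points does so with probability O(h ^ 2). *)
Lemma random_trig_tangent (K : nat) : P.-negligible [set w | exists t,
  circle_zeros (g w) t /\ forall s, `|g w s| <= K%:R * (s - t) ^+ 2].
Proof.
(* The [2 ^ k] grid points contribute [c0 * K * h ^+ 2] each, with [h = 2 * pi / 2 ^+ k]. *)
apply: (@negligible_small _ _ _ _ _ (c0 * K%:R * (2 * pi) ^+ 2)) => k.
pose h : R := dyadic_step k; have h0 : 0 < h := dyadic_step_gt0 k.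
pose A j := [set w | `|g w (j%:R * h)| <= K%:R * h ^+ 2].
exists (\big[setU/set0]_(j < 2 ^ k) A j); split.
- by apply: bigsetU_measurable => j _; exact: measurable_random_trig_le.
- move=> w /= [t [[/andP[t0 tpi] gt0] gt]].
  rewrite -bigcup_mkord.
  have /andP[c1 c2] := @truncn_itv _ (t / h) (divr_ge0 t0 (ltW h0)).
  rewrite ler_pdivlMr// in c1; rewrite ltr_pdivrMr// -natr1 mulrDl mul1r in c2.
  exists (Num.truncn (t / h)).
    rewrite /= -(ltr_nat R) -(ltr_pM2r h0) dyadic_step_end.
    exact: le_lt_trans c1 tpi.
  rewrite /A/=; apply: le_trans (gt _) _; rewrite ler_wpM2l//.
  rewrite -[leLHS]real_normK ?num_real// ler_pXn2r ?nnegrE ?(ltW h0)//.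
  by rewrite ler_norml; apply/andP; split; lra.
- apply: le_trans (Boole_inequality _ _ ) _.
    by move=> j _; exact: measurable_random_trig_le.
  apply: (@le_trans _ _ (\sum_(j < 2 ^ k) (c0 * (K%:R * h ^+ 2))%:E)%E).
    by apply: lee_sum => j _; apply: random_trig_small; rewrite mulr_ge0// sqr_ge0.
  rewrite sumEFin lee_fin sumr_const card_ord -[_ *+ (2 ^ k)]mulr_natr natrX.
  rewrite le_eqVlt; apply/orP; left; apply/eqP; rewrite /h /dyadic_step.
  by field; rewrite expf_neq0.
Qed.

Lemma random_trig_simple_zeros : P.-negligible [set w | ~ simple_zeros (g w)].
Proof.
apply: (@negligibleS _ _ _ _ (\bigcup_K [set w | exists t,
  circle_zeros (g w) t /\ forall s, `|g w s| <= K%:R * (s - t) ^+ 2])).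
  move=> w /= nsz; apply: contrapT => nt; apply: nsz => t tz.
  have [[K hK]|//] := Trig_zero (random_trig_Trig w) tz.2.
  by exfalso; apply: nt; exists K => //; exists t.
by apply: negligible_bigcup => K; exact: random_trig_tangent.
Qed.

Lemma random_trig_top_coefficient : (0 < m)%N ->
  P.-negligible [set w | L2_prod (g w) (fun t => cos (m%:R * t)) = 0].
Proof.
move=> m0; pose u i := L2_prod (e i) (fun t => cos (m%:R * t)).
have uu : 0 < dotp u u := onb_top_coefficient onb m0.
have cc : continuous (fun t : R => cos (m%:R * t)).
  by move=> t; under eq_fun do rewrite -[_ * _]subr0; exact: continuous_wave.
apply: (@negligible_small _ _ _ _ _ (2 * normal_peak 1 / Num.sqrt (dotp u u))) => l.
have l0 : 0 <= (2 ^+ l)^-1 :> R by rewrite invr_ge0 exprn_ge0.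
exists [set w | `|dotp (X ^~ w) u| <= (2 ^+ l)^-1]; split.
- exact: measurable_normr_le (measurable_dotp _ gX).
- move=> w /=; rewrite (L2_prod_lincomb onb (c := X ^~ w) cc (fun t => erefl)).
  by rewrite -/(dotp (X ^~ w) u) => ->; rewrite normr0.
- exact: gaussian_small_ball.
Qed.

Let change k j : set T := [set w | (g w (j%:R * dyadic_step k) < 0) !=
  (g w (j.+1%:R * dyadic_step k) < 0)].

Let measurable_change k j : measurable (change k j).
Proof.
by apply: measurable_neqb; apply: measurable_lt0; exact: measurable_random_trig.
Qed.

Let changesE k w : (dyadic_changes k (g w))%:R%:E =
  (\sum_(j < 2 ^ k) (\1_(change k j) w : R)%:E)%E.
Proof.
rewrite sumEFin /dyadic_changes /nsign_changes natr_sum big_mkord.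
congr EFin; apply: eq_bigr => j _; rewrite indicE; congr (nat_of_bool _)%:R.
by apply/idP/idP => [h|]; [exact: mem_set|rewrite inE].
Qed.

Lemma measurable_dyadic_changes k :
  measurable_fun setT (fun w => (dyadic_changes k (g w))%:R%:E : \bar R).
Proof.
under eq_fun do rewrite changesE.
apply: emeasurable_sum => j; apply/measurable_EFinP.
exact: measurable_indic.
Qed.

(** Linearity of expectation: the covariance depends only on the distance, so all cells have the
    same probability of a change. *)
Lemma expected_dyadic_changes k : (0 < m)%N ->
  0 <= angle m (dyadic_step k : R) <= pi / 2 ->
  (\int[P]_w (dyadic_changes k (g w))%:R%:E =
   ((2 ^ k)%:R * (angle m (dyadic_step k) / pi))%:E)%E.
Proof.
move=> m0 ang; under eq_integral do rewrite changesE.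
have Pch j : P (change k j) = (angle m (dyadic_step k) / pi)%:E.
  apply: (gaussian_sign_change gX _ D0_gt0 (dotp_e _) (dotp_e _) _ ang).
    by rewrite card_ord; exact: (onb_size_gt1 onb).
  rewrite /dotp (onb_dirichlet onb) angleK [RHS]mulrC divfK ?gt_eqF//.
  by congr (dirichlet m _); rewrite -natr1; ring.
rewrite ge0_integral_sum//; last first.
  by move=> j; apply/measurable_EFinP; exact: measurable_indic.
transitivity (\sum_(j < 2 ^ k) (angle m (dyadic_step k : R) / pi)%:E)%E.
  by apply: eq_bigr => j _; rewrite integral_indic// setIT; exact: Pch.
by rewrite sumEFin sumr_const card_ord mulr_natl.
Qed.

Lemma expected_circle_zeros : (0 < m)%N ->
  (\int[P]_w counting (circle_zeros (g w)) =
   (2 * Num.sqrt (m%:R * (m%:R + 1) / 3))%:E)%E.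
Proof.
move=> m0.
pose S k w : \bar R := (dyadic_changes k (g w))%:R%:E.
have S0 k w : (0 <= S k w)%E by rewrite lee_fin.
have ndS w : {homo S ^~ w : k l / (k <= l)%N >-> (k <= l)%E}.
  by move=> k l kl; rewrite lee_fin ler_nat; exact: nondecreasing_dyadic_changes.
transitivity (\int[P]_w limn (S ^~ w))%E.
  apply: ge0_integral_ae_eq.
  - by move=> w; exact: measure_ge0.
  - move=> w; apply: lime_ge; last by near=> k.
    exact/ereal_nondecreasing_is_cvgn.
  apply: (negligibleS _ (negligibleU random_trig_off_grid random_trig_simple_zeros)).
  move=> w /= neq; apply: contrapT => /not_orP[/contrapT og /contrapT sz].
  apply: neq; apply/esym/cvg_lim => //; apply: dyadic_changes_cvg => //.
  exact: continuous_Trig (random_trig_Trig w).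
rewrite monotone_convergence//; last first.
  by move=> k; exact: measurable_dyadic_changes.
apply/cvg_lim => //.
have [ang1 angc] := angle_cvg m0 (@dyadic_step_gt0 R) (@dyadic_step_cvg0 R).
apply: (@cvg_trans _ ((2 * (angle m (dyadic_step k : R) / dyadic_step k))%:E @[k --> \oo])).
  (* Only for large [k] is the angle known to be at most [pi / 2]. *)
  apply: near_eq_cvg; near=> k; rewrite expected_dyadic_changes//.
    have h0 : 0 < dyadic_step k :> R := dyadic_step_gt0 k.
    have Nh : (2 ^ k)%:R = 2 * pi / dyadic_step k :> R.
      by rewrite -(dyadic_step_end k) mulfK ?gt_eqF.
    congr EFin; rewrite Nh; move: (angle m (dyadic_step k)) => A.
    move: (dyadic_step k) h0 => h h0.
    by move: (@pi_gt0 R); move: (@pi R) => q q0; field; rewrite !gt_eqF.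
  have /andP[-> a1] : 0 <= angle m (dyadic_step k : R) <= 1 by near: k.
  by rewrite (le_trans a1)// pihalf_ge1.
apply: cvg_EFin; first by near=> k.
by apply: cvgM => //; exact: cvg_cst.
Unshelve. all: by end_near. Qed.

End gaussian_trig.

(** * Random real Laurent polynomials *)

Section random_laurent.
Context {R : realType} d (T : measurableType d) (P : probability T R).
Variables (m : nat) (f : T -> laurent R).
Hypotheses (m_gt0 : (0 < m)%N) (rf : random_real_laurent P m f).

Let representation : exists (n : nat) (e : 'I_n -> R -> R)
    (X : 'I_n -> T -> measurableTypeR R),
  [/\ Trig_orthonormal_basis m e, gaussian_family P X &
      forall w, circle_restr (f w) = random_trig e X w].
Proof.
have [_ [n [e [X [onb indep normal fE]]]]] := rf.
exists n, e, (fun i => X i); split => //; last first.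
  by move=> w; apply/funext => t; rewrite fE.
split => [i|A mA]; first exact: (measurable_funPT (X i)).
have := indep [set: 'I_n]%SET A mA.
rewrite (_ : \bigcap_(i in _) _ = \bigcap_i (X i @^-1` A i)); last first.
  by apply/seteqP; split => w h i _; apply: h => //=; rewrite finset.in_setT.
move=> ->; apply: eq_big => [i|i _]; first by rewrite inE.
exact: (normal i (A i) (mA i)).
Qed.

Lemma expected_nreal_rootsE : expected_nreal_roots P f =
  (2 * Num.sqrt (m%:R * (m%:R + 1) / 3))%:E.
Proof.
have [rl _] := rf; have [n [e [X [onb gX fE]]]] := representation.
rewrite -(expected_circle_zeros onb gX m_gt0) /expected_nreal_roots.
by apply: eq_integral => w _; rewrite nreal_roots_circle ?fE//; case: (rl w).
Qed.

(** Outside the null set of one Gaussian form both extreme coefficients are nonzero, which also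
    raises the degree from at most [m] to exactly [m]. *)
Lemma ae_nroots : {ae P, forall w, nroots (f w) = (2 * m)%N}.
Proof.
have [rl _] := rf; have [n [e [X [onb gX fE]]]] := representation.
apply: (negligibleS _ (random_trig_top_coefficient onb gX m_gt0)).
move=> w /= nr; apply: contrapT => c0; apply: nr.
have [ra am] := rl w.
have cg : continuous (circle_restr (f w)).
  by rewrite fE; exact: continuous_Trig (random_trig_Trig X onb w).
have [cN cP] := extreme_coef m_gt0 ra am cg.
have aP : f w m%:Z != 0 by apply/eqP => a0; apply: c0; rewrite -fE -cP a0.
have aN : f w (- m%:Z) != 0 by apply/eqP => a0; apply: c0; rewrite -fE -cN a0.
apply: nroots_eq => //; apply/eqP; rewrite eqn_leq am leqNgt; apply/negP => lt.
by move/eqP: aP; apply; apply: (laurent_deg_le (leqnn _)).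
Qed.

(** Two different almost sure values would make the whole space negligible. *)
Lemma as_nrootsE : as_nroots P f = (2 * m)%N.
Proof.
rewrite /as_nroots; case: xgetP => [N _ /= hN|/(_ (2 * m)%N)/(_ ae_nroots)//].
apply: contrapT => NN.
have : P.-negligible [set: T].
  apply: (negligibleS _ (negligibleU hN ae_nroots)) => w _ /=.
  apply/not_andP => -[h1 h2]; apply: NN; by rewrite -h1.
move=> /(negligibleP P measurableT) P0.
have /eqP := etrans (esym P0) (@probability_setT _ _ _ P).
by rewrite eq_sym onee_eq0.
Qed.

Lemma prob_real_rootE : prob_real_root P f =
  Num.sqrt ((m%:R + 1) / (3 * m%:R)).
Proof.
rewrite /prob_real_root expected_nreal_rootsE as_nrootsE/=.
have m0 : 0 < m%:R :> R by rewrite ltr0n.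
have -> : m%:R * (m%:R + 1) / 3 = m%:R ^+ 2 * ((m%:R + 1) / (3 * m%:R)) :> R.
  by field; rewrite gt_eqF.
rewrite sqrtrM ?sqr_ge0// sqrtr_sqr gtr0_norm// mulrA natrM.
by rewrite mulrAC divff ?mul1r// mulf_neq0// gt_eqF.
Qed.

End random_laurent.

Lemma sqrt_ratio_cvg (R : realType) :
  Num.sqrt ((m%:R + 1) / (3 * m%:R) : R) @[m --> \oo] --> (Num.sqrt 3 : R)^-1.
Proof.
rewrite -sqrtrV//.
have h : ((m%:R + 1) / (3 * m%:R) : R) @[m --> \oo] --> (3^-1 : R).
  (* The ratio at index [m + 1]; the shift removes the zero denominator at [m = 0]. *)
  have h1 : 3^-1 * (1 + (m.+1%:R : R)^-1) @[m --> \oo] --> (3^-1 : R).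
    rewrite -[X in _ --> X]mulr1; apply: cvgM; first exact: cvg_cst.
    rewrite -[X in _ --> X]addr0; apply: cvgD; first exact: cvg_cst.
    exact: cvg_harmonic.
  rewrite -cvg_shiftS; apply: cvg_trans h1; apply: near_eq_cvg; near=> m.
  by rewrite /=; field; rewrite ?natr1 ?nat1r pnatr_eq0.
by apply: (cvg_comp _ _ h); exact: sqrt_continuous.
Unshelve. all: by end_near. Qed.

Theorem theorem2 (R : realType) (d : nat -> measure_display)
    (T : forall m : nat, measurableType (d m))
    (P : forall m : nat, probability (T m) R)
    (f : forall m : nat, T m -> laurent R) :
  (forall m : nat, (1 <= m)%N -> random_real_laurent (P m) m (f m) ->
     expected_nreal_roots (P m) (f m)
       = (2 * Num.sqrt (m%:R * (m%:R + 1) / 3))%:E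
     /\ prob_real_root (P m) (f m)
       = Num.sqrt ((m%:R + 1) / (3 * m%:R)))
  /\
  ((forall m : nat, (1 <= m)%N -> random_real_laurent (P m) m (f m)) ->
     prob_real_root (P m) (f m) @[m --> \oo] --> (Num.sqrt 3)^-1).
Proof.
split=> [m m1 rf|rf].
  by split; [exact: expected_nreal_rootsE|exact: prob_real_rootE].
apply: cvg_trans (@sqrt_ratio_cvg R); apply: near_eq_cvg; near=> m.
have m1 : (1 <= m)%N by near: m; exists 1%N.
by rewrite (prob_real_rootE m1 (rf m m1)).
Unshelve. all: by end_near. Qed.
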